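(* Let $a,b\in\mathbb{R}\setminus\{0\}$, let $$W(x)=e^{-x^{2}}\begin{pmatrix} e^{2bx}+a^{2}x^{2} & ax\\ ax & 1\end{pmatrix},\quad x\in\mathbb{R},$$ and let $$D=\partial^{2}I+\partial\begin{pmatrix}-2x+2b & -2abx+2a\\ 0 & -2x\end{pmatrix}+\begin{pmatrix}-2&0\\0&0\end{pmatrix}\in\mathcal D(W).$$ Then the algebra $\mathcal D(W)$ coincides with the centralizer $\{\mathfrak D\in\mathcal D(W):\mathfrak D D=D\mathfrak D\}$ of $D$ in $\mathcal D(W)$. In particular, $\mathcal D(W)$ is a polynomial algebra in the differential operator $D$, i.e. $\mathcal D(W)=\mathbb{C}[D]$.
   Context: Differential operators $\mathfrak D=\sum_{j=0}^s\partial^jF_j(x)$, $\partial=\frac{d}{dx}$, with $F_j\in\operatorname{Mat}_2(\mathbb{C}[x])$, act on the right on $2\times2$ matrix-valued functions by $P\mathfrak D=\sum_jP^{(j)}(x)F_j(x)$; $\operatorname{Mat}_2(\Omega[x])$ denotes the algebra of these, with product given by $P(\mathfrak D_1\mathfrak D_2)=(P\mathfrak D_1)\mathfrak D_2$. Let $\{P_n\}_{n\ge0}$ be the sequence of monic orthogonal polynomials in $\operatorname{Mat}_2(\mathbb{C}[x])$ for $\langle P,Q\rangle=\int_{\mathbb{R}}P(x)W(x)Q(x)^*dx$ ($P_n$ of degree $n$ with leading coefficient $I$, $\langle P_n,P_m\rangle=0$ for $n\ne m$). Then $$\mathcal D(W)=\{\mathfrak D\in\operatorname{Mat}_2(\Omega[x]):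 P_n\mathfrak D=\Lambda_n(\mathfrak D)P_n\text{ with }\Lambda_n(\mathfrak D)\in\operatorname{Mat}_2(\mathbb{C}),\text{ for all }n\in\mathbb{N}_0\}.$$ *)

(* Defs.v *)
From HB Require Import structures.
From mathcomp Require Import all_boot all_order all_algebra.
From mathcomp Require Import complex.
From mathcomp Require Import all_classical all_reals all_analysis.

Set Implicit Arguments.
Unset Strict Implicit.
Unset Printing Implicit Defensive.

Import Order.TTheory GRing.Theory Num.Theory.

Local Open Scope ring_scope.
Local Open Scope complex_scope.

Definition mx22 (T : Type) (a b c d : T) : 'M[T]_2 :=
  \matrix_(i, j) (if i == 0 then (if j == 0 then a else b)
                  else (if j == 0 then c else d)).

(* Mat_2(K[x]) is 'M[{poly K}]_2; derivatives are taken entrywise. *)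
Definition mxderiv (K : nzRingType) (P : 'M[{poly K}]_2) : 'M[{poly K}]_2 :=
  map_mx (@deriv K) P.

Definition mxderivn (K : nzRingType) (j : nat) (P : 'M[{poly K}]_2) :
  'M[{poly K}]_2 := map_mx (derivn j) P.

(* A differential operator sum_j d^j F_j(x) is encoded by its sequence of
   coefficients F_j, i.e. by the polynomial whose coefficient of degree j is
   F_j.  The ring structure of {poly _} is not the one of the operators, hence
   the wrapper: the product of operators is dop_mul below. *)
Record diffop (K : nzRingType) := DiffOp { dop_coef : {poly 'M[{poly K}]_2} }.

HB.instance Definition _ (K : nzRingType) := [isNew for @dop_coef K].
HB.instance Definition _ (K : nzRingType) := [Choice of diffop K by <:].

Section DiffOp.
Variable K : numFieldType.
Local Notation M := ('M[{poly K}]_2).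
Implicit Types (P F : M) (D E G : diffop K).

(* The right action P D = sum_j P^(j) F_j. *)
Definition dop_act (P : M) (D : diffop K) : M :=
  \sum_(j < size (dop_coef D)) mxderivn j P *m (dop_coef D)`_j.

Definition dop_zero : diffop K := DiffOp 0.
Definition dop_opp (D : diffop K) := DiffOp (- dop_coef D).
Definition dop_add (D E : diffop K) := DiffOp (dop_coef D + dop_coef E).

Lemma dop_addA : associative dop_add.
Proof. by move=> D E G; apply: val_inj; rewrite /= addrA. Qed.
Lemma dop_addC : commutative dop_add.
Proof. by move=> D E; apply: val_inj; rewrite /= addrC. Qed.
Lemma dop_add0 : left_id dop_zero dop_add.
Proof. by move=> D; apply: val_inj; rewrite /= add0r. Qed.
Lemma dop_addN : left_inverse dop_zero dop_opp dop_add.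
Proof. by move=> D; apply: val_inj; rewrite /= addNr. Qed.

HB.instance Definition _ := GRing.isZmodule.Build (diffop K)
  dop_addA dop_addC dop_add0 dop_addN.

Definition dop_mx (F : M) : diffop K := DiffOp F%:P.
Definition dop_d : diffop K := DiffOp 'X.

(* (sum_j d^j F_j) d = sum_j (d^(j+1) F_j + d^j F_j'), since
   (P^(j) F_j)' = P^(j+1) F_j + P^(j) F_j'. *)
Definition dop_muld (p : {poly M}) : {poly M} :=
  p * 'X + map_poly (@mxderiv K) p.

(* D (sum_k d^k G_k) = sum_k (D d^k) G_k; see dop_actM. *)
Definition dop_mul (D G : diffop K) : diffop K :=
  DiffOp (\sum_(k < size (dop_coef G))
            iter k dop_muld (dop_coef D) * ((dop_coef G)`_k)%:P).

Definition dop_scale (c : K) (D : diffop K) : diffop K :=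
  DiffOp ((c%:P)%:M *: dop_coef D).

Lemma mxderivn0 P : mxderivn 0 P = P.
Proof. by apply/matrixP=> i j; rewrite mxE derivn0. Qed.
Lemma mxderivnS n P : mxderivn n.+1 P = mxderiv (mxderivn n P).
Proof. by apply/matrixP=> i j; rewrite !mxE derivnS. Qed.
Lemma mxderiv0 : mxderiv 0 = 0 :> M.
Proof. by apply/matrixP=> i j; rewrite !mxE deriv0. Qed.
Lemma mxderivD : {morph @mxderiv K : P F / P + F}.
Proof. by move=> P F; apply/matrixP=> i j; rewrite !mxE derivD. Qed.
Lemma mxderivnD n : {morph @mxderivn K n : P F / P + F}.
Proof. by move=> P F; apply/matrixP=> i j; rewrite !mxE derivnD. Qed.
Lemma mxderiv_sum I (r : seq I) (F : I -> M) :
  mxderiv (\sum_(i <- r) F i) = \sum_(i <- r) mxderiv (F i).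
Proof. exact: (big_morph _ mxderivD mxderiv0). Qed.
Lemma mxderivM P F : mxderiv (P *m F) = mxderiv P *m F + P *m mxderiv F.
Proof.
apply/matrixP=> i j; rewrite !mxE raddf_sum -big_split /=.
by apply: eq_bigr => k _; rewrite !mxE derivM.
Qed.
Lemma mxderivnXn m n :
  mxderivn n (('X^m)%:M : M) = ('X^(m - n) *+ m ^_ n)%:M.
Proof.
apply/matrixP=> i j; rewrite !mxE; case: eqP => _; rewrite ?mulr1n ?derivnXn //.
by rewrite !mulr0n -polyC0 derivnC; case: ifP.
Qed.

Lemma dop_actEw n P D : (size (dop_coef D) <= n)%N ->
  dop_act P D = \sum_(j < n) mxderivn j P *m (dop_coef D)`_j.
Proof.
move=> le_n; rewrite /dop_act -!(big_mkord xpredT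
  (fun j => mxderivn j P *m (dop_coef D)`_j)).
rewrite [RHS](big_cat_nat (leq0n _) le_n) /= [X in _ = _ + X]big1_seq ?addr0 // => j.
by rewrite mem_index_iota => /andP[_ /andP[lej _]]; rewrite nth_default ?mulmx0.
Qed.

Lemma dop_actDl P F D : dop_act (P + F) D = dop_act P D + dop_act F D.
Proof.
by rewrite /dop_act -big_split; apply: eq_bigr => j _; rewrite mxderivnD mulmxDl.
Qed.

Lemma dop_actDr P D E : dop_act P (D + E) = dop_act P D + dop_act P E.
Proof.
set n := maxn (size (dop_coef D)) (size (dop_coef E)).
rewrite !(@dop_actEw n) ?leq_maxl ?leq_maxr //; last exact: size_polyD.
by rewrite -big_split; apply: eq_bigr => j _; rewrite coefD mulmxDr.
Qed.

Lemma dop_act0r P : dop_act P 0 = 0.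
Proof. by rewrite (@dop_actEw 0) ?big_ord0 //= size_poly0. Qed.

Lemma dop_actNr P D : dop_act P (- D) = - dop_act P D.
Proof. by apply/eqP; rewrite -addr_eq0 -dop_actDr addNr dop_act0r. Qed.

Lemma dop_act_sum P I (r : seq I) (F : I -> {poly M}) :
  dop_act P (DiffOp (\sum_(i <- r) F i)) = \sum_(i <- r) dop_act P (DiffOp (F i)).
Proof.
elim/big_ind2: _ => [|p x q y <- <-|//]; first exact: dop_act0r.
by rewrite -dop_actDr.
Qed.

Lemma dop_act_muld P D :
  dop_act P (DiffOp (dop_muld (dop_coef D))) = mxderiv (dop_act P D).
Proof.
set p := dop_coef D; set n := size p.
have map0 : (size (map_poly (@mxderiv K) p) <= n)%N by apply: size_poly.
rewrite (_ : DiffOp _ = DiffOp (p * 'X) + DiffOp (map_poly (@mxderiv K) p)) //.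
rewrite dop_actDr (@dop_actEw n.+1); last first.
  by have [->|p0] := eqVneq p 0; rewrite ?mul0r ?size_poly0 ?size_mulX.
rewrite (@dop_actEw n) //= /dop_act mxderiv_sum.
rewrite big_ord_recl coefMX eqxx mulmx0 add0r -big_split.
apply: eq_bigr => j _; rewrite lift0 coefMX /= coef_map_id0 ?mxderiv0 //.
by rewrite mxderivM mxderivnS.
Qed.

Lemma dop_act_mulC P D F :
  dop_act P (DiffOp (dop_coef D * F%:P)) = dop_act P D *m F.
Proof.
rewrite (@dop_actEw (size (dop_coef D))) /=; last first.
  by apply/leq_sizeP => j lej; rewrite coefMC nth_default ?mul0r.
rewrite /dop_act mulmx_suml; apply: eq_bigr => j _.
by rewrite coefMC mulmxA.
Qed.

(* The defining property of the product of operators. *)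
Lemma dop_actM P D G : dop_act P (dop_mul D G) = dop_act (dop_act P D) G.
Proof.
rewrite /dop_mul dop_act_sum /=; apply: eq_bigr => k _.
rewrite (dop_act_mulC _ (DiffOp (iter k dop_muld (dop_coef D)))); congr (_ *m _).
elim: {k}(k : nat) => [|k IHk]; first by rewrite mxderivn0; case: D.
by rewrite iterS (dop_act_muld _ (DiffOp _)) IHk mxderivnS.
Qed.

Lemma dop_act_eq0 D : (forall P, dop_act P D = 0) -> D = 0.
Proof.
move=> D0; apply: val_inj => /=; apply/polyP => n; rewrite coef0.
elim/ltn_ind: n => n IHn.
have := D0 ('X^n)%:M; rewrite (@dop_actEw (n.+1 + size (dop_coef D))) ?leq_addl//.
rewrite big_split_ord /= [X in _ + X]big1 ?addr0; last first.
  move=> j _; rewrite mxderivnXn ffact_small ?mulr0n ?leq_addr//.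
  by rewrite raddf0 mul0mx.
rewrite big_ord_recr /= big1 ?add0r; last by move=> j _; rewrite IHn ?mulmx0.
rewrite mxderivnXn subnn expr0 ffactnn mul_scalar_mx => /matrixP E.
apply/matrixP => i j; have /eqP := E i j.
rewrite !mxE mulf_eq0 => /orP[|/eqP//].
by rewrite -polyC_natr polyC_eq0 pnatr_eq0 eqn0Ngt fact_gt0.
Qed.

Lemma dop_act_inj D E : (forall P, dop_act P D = dop_act P E) -> D = E.
Proof.
move=> DE; apply/eqP; rewrite -subr_eq0; apply/eqP/dop_act_eq0 => P.
by rewrite dop_actDr dop_actNr DE subrr.
Qed.

Lemma dop_act_mx P F : dop_act P (dop_mx F) = P *m F.
Proof.
rewrite (@dop_actEw 1) ?size_polyC_leq1 // big_ord1 mxderivn0 coefC //.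
Qed.

Lemma dop_act_d P : dop_act P dop_d = mxderiv P.
Proof.
rewrite (@dop_actEw 2) ?size_polyX // big_ord_recl big_ord1 /= !coefX /=.
by rewrite mulmx0 add0r mulmx1 mxderivnS mxderivn0.
Qed.

Lemma dop_actZr P c D : dop_act P (dop_scale c D) = (c%:P) *: dop_act P D.
Proof.
rewrite (@dop_actEw (size (dop_coef D))) /=; last first.
  by apply/leq_sizeP => j lej; rewrite coefZ nth_default ?mulr0.
rewrite /dop_act scaler_sumr; apply: eq_bigr => j _.
by rewrite coefZ -[_ * _]/(_ *m _) mul_scalar_mx scalemxAr.
Qed.

Lemma dop_actZl P c D : dop_act (c%:P *: P) D = (c%:P) *: dop_act P D.
Proof.
rewrite /dop_act scaler_sumr; apply: eq_bigr => j _; rewrite scalemxAl.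
congr (_ *m _); apply/matrixP => i k; rewrite !mxE.
by rewrite !mul_polyC derivnZ.
Qed.

Lemma dop_mulA : associative dop_mul.
Proof. by move=> D E G; apply: dop_act_inj => P; rewrite !dop_actM. Qed.
Lemma dop_mul1l : left_id (dop_mx 1) dop_mul.
Proof.
by move=> D; apply: dop_act_inj => P; rewrite dop_actM dop_act_mx mulmx1.
Qed.
Lemma dop_mul1r : right_id (dop_mx 1) dop_mul.
Proof.
by move=> D; apply: dop_act_inj => P; rewrite dop_actM dop_act_mx mulmx1.
Qed.
Lemma dop_mulDl : left_distributive dop_mul +%R.
Proof.
move=> D E G; apply: dop_act_inj => P.
by rewrite dop_actM !dop_actDr dop_actDl !dop_actM.
Qed.
Lemma dop_mulDr : right_distributive dop_mul +%R.
Proof.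
by move=> D E G; apply: dop_act_inj => P; rewrite !(dop_actM, dop_actDr).
Qed.
Lemma dop_1_neq0 : dop_mx 1 != 0.
Proof. by apply/eqP => /(congr1 (@dop_coef K))/eqP; rewrite /= polyC_eq0 oner_eq0. Qed.

HB.instance Definition _ := GRing.Zmodule_isNzRing.Build (diffop K)
  dop_mulA dop_mul1l dop_mul1r dop_mulDl dop_mulDr dop_1_neq0.

Lemma dop_scaleA c d D : dop_scale c (dop_scale d D) = dop_scale (c * d) D.
Proof. by apply: dop_act_inj => P; rewrite !dop_actZr scalerA polyCM. Qed.
Lemma dop_scale1 : left_id 1 dop_scale.
Proof. by move=> D; apply: dop_act_inj => P; rewrite dop_actZr scale1r. Qed.
Lemma dop_scaleDr : right_distributive dop_scale +%R.
Proof.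
move=> c D E; apply: dop_act_inj => P.
by rewrite !(dop_actZr, dop_actDr) scalerDr.
Qed.
Lemma dop_scaleDl D : {morph dop_scale^~ D : c d / c + d}.
Proof.
move=> c d; apply: dop_act_inj => P.
by rewrite !(dop_actZr, dop_actDr) polyCD scalerDl.
Qed.

HB.instance Definition _ := GRing.Zmodule_isLmodule.Build K (diffop K)
  dop_scaleA dop_scale1 dop_scaleDr dop_scaleDl.

Lemma dop_scaleAl c D E : c *: (D * E) = c *: D * E.
Proof.
apply: dop_act_inj => P.
by rewrite dop_actZr !dop_actM dop_actZr dop_actZl.
Qed.

HB.instance Definition _ :=
  GRing.Lmodule_isLalgebra.Build K (diffop K) dop_scaleAl.

Lemma dop_scaleAr c D E : c *: (D * E) = D * (c *: E).
Proof.
by apply: dop_act_inj => P; rewrite dop_actZr !dop_actM dop_actZr.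
Qed.

HB.instance Definition _ :=
  GRing.Lalgebra_isAlgebra.Build K (diffop K) dop_scaleAr.

End DiffOp.

Section OrthogonalPolynomials.
Variable R : realType.
Local Notation C := R[i].

Definition mxeval (P : 'M[{poly C}]_2) (z : C) : 'M[C]_2 :=
  map_mx (horner^~ z) P.

Definition adjmx (A : 'M[C]_2) : 'M[C]_2 := map_mx Num.conj A^T.

Definition cintegral (f : R -> C) : C :=
  (\int[lebesgue_measure]_x complex.Re (f x)) +i*
  (\int[lebesgue_measure]_x complex.Im (f x)).

Definition mxinner (W : R -> 'M[C]_2) (P Q : 'M[{poly C}]_2) : 'M[C]_2 :=
  \matrix_(i, j) cintegral (fun x : R =>
    (mxeval P x%:C *m W x *m adjmx (mxeval Q x%:C)) i j).

Definition mxmonic (n : nat) (P : 'M[{poly C}]_2) :=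
  map_mx (coefp n) P = 1%:M /\
  forall k, (n < k)%N -> map_mx (coefp k) P = 0.

Definition monic_orthogonal (W : R -> 'M[C]_2) (P : nat -> 'M[{poly C}]_2) :=
  (forall n, mxmonic n (P n)) /\
  (forall n m, n != m -> mxinner W (P n) (P m) = 0).

(* The algebra D(W).  The existential quantifier picks the sequence of monic
   orthogonal polynomials of W, which is unique. *)
Definition DW (W : R -> 'M[C]_2) : set (diffop C) :=
  [set D | exists2 P : nat -> 'M[{poly C}]_2, monic_orthogonal W P &
     forall n, exists L : 'M[C]_2,
       dop_act (P n) D = map_mx polyC L *m P n].

Definition W_ex (a b : R) (x : R) : 'M[C]_2 :=
  (expR (- x ^+ 2))%:C *:
    mx22 ((expR (2 * b * x) + a ^+ 2 * x ^+ 2)%:C) ((a * x)%:C)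
         ((a * x)%:C)                              1.

Definition D_ex (a b : R) : diffop C :=
  dop_d C ^+ 2 * dop_mx 1
  + dop_d C * dop_mx
      (mx22 (- 2%:P * 'X + (2 * b%:C)%:P)
              (- (2 * a%:C * b%:C)%:P * 'X + (2 * a%:C)%:P)
            0 (- 2%:P * 'X))
  + dop_mx (mx22 (- 2%:P) 0 0 0).

End OrthogonalPolynomials.

(* Main.v *)
Require Import Defs.
From HB Require Import structures.
From mathcomp Require Import all_boot all_order all_algebra.
From mathcomp Require Import complex.
From mathcomp Require Import all_classical all_reals all_analysis.
From mathcomp Require Import measurable_realfun zify ring lra.

Import Order.TTheory GRing.Theory Num.Theory.
Local Open Scope classical_set_scope.
Local Open Scope ring_scope.

(* With T = [[1, a x], [0, 1]] one has W = T diag(e^(-x^2 + 2bx), e^(-x^2)) T^*,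
   so in the coordinates P T the inner product splits into the two scalar
   Gaussian functionals Lb and L0, with Hermite polynomials H_n (centred at b)
   and h_n.  The orthogonal polynomials are then explicit: up to an invertible
   constant, P_n T has rows (H_n, a h_(n+1)) and (- tau H_n', h_n), and both are
   eigenvectors of T^-1 D T = diag(delta_b - 2, delta_0).  Conversely, let E be in
   D(W) and f_ij be the entries of T^-1 E T.  The eigenvalue equations of E force
   f_10 h_n and f_01 H_n to be short combinations of H_k, resp. h_k, with k close
   to n; as f_ij is a differential operator, a nonzero f_10 or f_01 would yield
   nonzero polynomials r, s with L0 (q s) = Lb (q r) for all q, which is impossible
   because e^(2bx) is not rational.  So T^-1 E T is diagonal, with
   f_11 h_n = beta_n h_n and f_00 H_n = beta_(n+1) H_n; since beta_n is polynomial
   in n, beta_n = g(-2n) for some g, and E = g(D). *)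

Set Implicit Arguments.
Unset Strict Implicit.
Unset Printing Implicit Defensive.

(** * Gaussian moments *)

Section GaussianMoments.
Import numFieldNormedType.Exports.
Variable R : realType.
Implicit Types (c x : R) (r : {poly R}).
Local Notation mu := (@lebesgue_measure R).

(** This is e^(c^2) times the Gaussian e^(-(x - c)^2) centred at [c]. *)
Definition gauss_weight c x : R := expR (- x ^+ 2) * expR (2 * c * x).

(** Each Horner step multiplies by [x]; since |x| <= e^|x|, this costs one unit in the exponent
    [k]. *)
Lemma horner_exp_bound r :
  exists C k : R, [/\ 0 <= C, 0 <= k & forall x, `|r.[x]| <= C * expR (k * `|x|)].
Proof.
elim/poly_ind: r => [|r c [C [k [C0 k0 IH]]]].
  by exists 0, 0; split=> // x; rewrite horner0 normr0 mul0r.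
exists (C + `|c|), (k + 1); split; rewrite ?addr_ge0 // => x.
rewrite hornerMXaddC (le_trans (ler_normD _ _)) // mulrDl lerD //.
  rewrite normrM mulrDl mul1r expRD mulrA ler_pM //.
  by rewrite (le_trans _ (expR_ge1Dx _)) // lerDr.
by rewrite ler_peMr // -expR0 ler_expR mulr_ge0 // addr_ge0.
Qed.

(** Completing the square, K |x| <= K^2 / 2 + x^2 / 2, so half of the Gaussian decay absorbs all
    exponential growth and the other half survives. *)
Lemma horner_gauss_weight_bound c r : exists M : R, 0 <= M /\
  forall x, `|r.[x] * gauss_weight c x| <= M * expR (- x ^+ 2 / 2).
Proof.
have [C [k [C0 k0 hC]]] := horner_exp_bound r.
set K := k + `|2 * c|.
exists (C * expR (K ^+ 2 / 2)); split=> [|x]; first by rewrite mulr_ge0 ?expR_ge0.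
rewrite normrM (ger0_norm (mulr_ge0 _ _)) ?expR_ge0 //.
apply: le_trans (ler_wpM2r _ (hC x)) _; first by rewrite mulr_ge0 ?expR_ge0.
rewrite -!mulrA ler_wpM2l // -!expRD ler_expR.
have hcx : 2 * c * x <= `|2 * c| * `|x| by rewrite -normrM ler_norm.
have := sqr_ge0 (K - `|x|); rewrite sqrrB -[x ^+ 2]real_normK ?num_real // /K.
by move: (`|x|) (`|2 * c|) hcx (2 * c * x) => y d h z ?; nra.
Qed.


Lemma continuous_gauss_weight c r : continuous (fun x => r.[x] * gauss_weight c x).
Proof.
move=> x; apply: cvgM; first exact: continuous_horner.
apply: cvgM; (apply: continuous_comp; last exact: continuous_expR).
  by apply: continuousN; exact: exprn_continuous.
exact: mulrl_continuous.
Qed.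

Lemma integrable_gauss_weight c r :
  mu.-integrable setT (EFin \o (fun x => r.[x] * gauss_weight c x)).
Proof.
have [M [M0 hM]] := horner_gauss_weight_bound c r.
have [s1 s0] : 1 != 0 :> R /\ normal_peak (1 : R) != 0.
  by split; [|apply: lt0r_neq0; apply: normal_peak_gt0]; rewrite ?oner_neq0.
(* The dominating function M e^(-x^2 / 2), written as a multiple of the standard normal density,
   whose integrability is known. *)
pose g x := (M / normal_peak 1) * normal_pdf 0 1 x.
have ig : mu.-integrable setT (EFin \o g).
  rewrite (_ : EFin \o g = fun x => ((M / normal_peak 1)%:E * (normal_pdf 0 1 x)%:E)%E) //.
  by apply: integrableZl => //; exact: integrable_normal_pdf.
apply: (le_integrable measurableT _ _ ig).
  by apply/measurable_EFinP; apply: continuous_measurable_fun;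
    exact: continuous_gauss_weight.
move=> x _; rewrite /= lee_fin; apply: le_trans (hM x) _.
rewrite /g normal_pdfE // /normal_fun subr0 expr1n mulrA mulfVK //.
by rewrite ger0_norm ?mulr_ge0 ?expR_ge0.
Qed.

(** The integral over [-n, n] is F(n) - F(-n), which tends to 0; dominated convergence by |f|
    identifies its limit with the full integral. *)
Lemma Rintegral_derivative_eq0 (F f : R -> R) :
  (forall x, is_derive x 1 F (f x)) -> continuous f ->
  mu.-integrable setT (EFin \o f) ->
  F n%:R @[n --> \oo] --> 0 -> F (- n%:R) @[n --> \oo] --> 0 ->
  \int[mu]_x f x = 0.
Proof.
move=> dF cf intf F0 F0'.
have cF : continuous F.
  move=> x; apply/differentiable_continuous/derivable1_diffP.
  by case: (dF x).
pose I n : set R := `[- n%:R, n%:R]%classic.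
have mf : measurable_fun setT (EFin \o f) by exact: measurable_int intf.
pose fn n x := (EFin \o f \_ (I n)) x.
have [] // := @dominated_convergence _ _ R mu setT measurableT fn (EFin \o f)
  (abse \o EFin \o f).
- move=> n; rewrite /fn; apply/measurable_EFinP.
  apply/(measurable_restrictT _ (measurable_itv _)).
  by apply: measurable_funS (continuous_measurable_fun cf).
- apply: aeW => x _; apply: cvg_near_cst.
  near=> n; rewrite /fn /= patchE ifT // inE /I /= in_itv /= -ler_norml.
  by near: n; exact: nbhs_infty_ger.
- exact: integrable_abse.
- apply: aeW => x n _; rewrite /fn /= patchE.
  by case: ifPn => // _; rewrite normr0 lee_fin.
move=> _ _ cv.
have cv0 : (fun n => \int[mu]_x fn n x)%E @ \oo --> 0%E.
  (* The index is shifted by one because the fundamental theorem of calculus is applied on a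
     nondegenerate interval. *)
  have : (fun n => (F n.+1%:R - F (- n.+1%:R))%:E) @ \oo --> (0 - 0 : R)%:E.
    apply: cvg_EFin; first exact: nearW.
    by apply: cvgB; [move: F0 | move: F0']; rewrite -cvg_shiftS.
  rewrite subr0 => h; rewrite -cvg_shiftS; apply: cvg_trans h.
  apply: near_eq_cvg; near=> n.
  rewrite EFinB -(@continuous_FTC2 _ f F) //.
  - by rewrite [LHS]integral_mkcond; apply: eq_integral => x _; rewrite /fn restrict_EFin.
  - by rewrite gtrN.
  - exact: continuous_subspaceT.
  - by split; [move=> x _; case: (dF x)
    | apply: cvg_at_right_filter; exact: cF | apply: cvg_at_left_filter; exact: cF].
  - by move=> x _; rewrite derive1E; case: (dF x).
by rewrite /Rintegral -(cvg_lim _ cv) // (cvg_lim _ cv0).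
Unshelve. all: by end_near.
Qed.

Lemma cvg_horner_gauss_weight c r (u : nat -> R) : (forall n, `|u n| = n%:R) ->
  r.[u n] * gauss_weight c (u n) @[n --> \oo] --> 0.
Proof.
move=> hu; have [M [M0 hM]] := horner_gauss_weight_bound c r.
apply: norm_cvg0; apply: (@squeeze_cvgr _ _ _ _ (cst 0) (fun n => M * 2 * (expR (- n%:R)))).
- near=> n; rewrite normr_ge0 /= (le_trans (hM _)) // -mulrA ler_wpM2l //.
  rewrite -[u n ^+ 2]real_normK ?num_real // hu.
  (* The bracket is 1/2 - (n - 1)^2 / 2, hence at most 1/2, and e^(1/2) <= 2 because e^(-1/2) >=
     1/2; this explains the factor 2 in the bound. *)
  have {1}-> : - n%:R ^+ 2 / 2 = (1/2 - n%:R ^+ 2 / 2 + n%:R - 1/2) - n%:R :> R by lra.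
  rewrite expRD ler_wpM2r ?expR_ge0 //.
  apply: le_trans (_ : expR (1/2 : R) <= _).
    rewrite ler_expR; have := sqr_ge0 (n%:R - 1 : R); nra.
  have := expR_ge1Dx (- (1/2) : R); have := expRxMexpNx_1 (1/2 : R).
  have := expR_gt0 (1/2 : R); nra.
- exact: cvg_cst.
- rewrite -[X in _ --> X](mulr0 (M * 2)); apply: cvgMr.
  have h := @cvgr_expR R; apply: (cvg_comp (fun n => n%:R) (fun x => expR (- x)) _ h).
  exact: cvgr_idn.
Unshelve. all: by end_near.
Qed.

Definition gauss_moment c r := \int[mu]_x (r.[x] * gauss_weight c x).

(** The integrand is the derivative of [r] times the weight, which vanishes at both ends. *)
Lemma gauss_moment_ibp c r :
  gauss_moment c (r^`() - ('X - c%:P) * r *+ 2) = 0.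
Proof.
apply: (@Rintegral_derivative_eq0 (fun x => r.[x] * gauss_weight c x)).
- move=> x.
  have -> : (r^`() - ('X - c%:P) * r *+ 2).[x] * gauss_weight c x =
    r.[x] * (- (2 * x) * gauss_weight c x + 2 * c * gauss_weight c x)
    + gauss_weight c x * r^`().[x].
    by rewrite hornerD hornerN hornerMn hornerM hornerXsubC; ring.
  rewrite /gauss_weight; apply: is_derive_eq.
  rewrite /GRing.scale /=; ring.
- exact: continuous_gauss_weight.
- exact: integrable_gauss_weight.
- by apply: (@cvg_horner_gauss_weight c r (fun n => n%:R)) => n; rewrite ger0_norm.
- by apply: (@cvg_horner_gauss_weight c r (fun n => - n%:R)) => n; rewrite normrN ger0_norm.
Qed.

Lemma gauss_moment_gt0 c : 0 < gauss_moment c 1.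
Proof.
(* With variance 1/2 the normal density of mean [c] is proportional to e^(-(x - c)^2), so the moment
   is a positive multiple of its total mass 1. *)
pose s : R := Num.sqrt (1 / 2).
have s2 : s ^+ 2 *+ 2 = 1 by rewrite sqr_sqrtr; lra.
have s0 : s != 0 by apply/eqP => s0; move: s2; rewrite s0 expr0n mul0rn; lra.
have p0 := normal_peak_gt0 s0.
have int1 : \int[mu]_x normal_pdf c s x = 1.
  by rewrite /Rintegral integral_normal_pdf.
have -> : gauss_moment c 1 = (expR (c ^+ 2) / normal_peak s) * 1.
  rewrite -int1 -RintegralZl //; last exact: integrable_normal_pdf.
  apply: eq_Rintegral => x _.
  rewrite hornerC mul1r normal_pdfE // /normal_fun s2 divr1 mulrA mulfVK ?gt_eqF //.
  by rewrite /gauss_weight -!expRD; congr expR; ring.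
by rewrite mulr1 divr_gt0 ?expR_gt0.
Qed.

Lemma gauss_momentD c r s : gauss_moment c (r + s) = gauss_moment c r + gauss_moment c s.
Proof.
rewrite /gauss_moment -RintegralD //; try exact: integrable_gauss_weight.
by apply: eq_Rintegral => x _; rewrite hornerD mulrDl.
Qed.

Lemma gauss_momentZ c k r : gauss_moment c (k *: r) = k * gauss_moment c r.
Proof.
rewrite /gauss_moment -RintegralZl //; last exact: integrable_gauss_weight.
by apply: eq_Rintegral => x _; rewrite hornerZ -mulrA.
Qed.

End GaussianMoments.
Set Implicit Arguments.
Unset Strict Implicit.
Unset Printing Implicit Defensive.

(** * Hermite polynomials and Gaussian functionals *)

Section HermitePolynomials.
Variables (K : numFieldType) (c : K).
Implicit Types p q r s : {poly K}.

(* The monic orthogonal polynomials of exp (- x^2 + 2 c x). *)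
Fixpoint herm n : {poly K} :=
  if n is m.+1 then ('X - c%:P) * herm m - 2^-1 *: (herm m)^`() else 1.

Lemma herm0 : herm 0 = 1. Proof. by []. Qed.

Lemma hermS n : herm n.+1 = ('X - c%:P) * herm n - 2^-1 *: (herm n)^`().
Proof. by []. Qed.

(** The Appell property: differentiating the recursion gives H_n plus n copies of the same recursion
    one degree lower. *)
Lemma deriv_herm n : (herm n)^`() = herm n.-1 *+ n.
Proof.
elim: n => [|n IHn]; first by rewrite derivC.
rewrite hermS derivB derivM derivXsubC mul1r derivZ IHn derivMn /=.
case: n IHn => [|n] IHn; first by rewrite !mulr0n mulr0 scaler0 addr0 subr0.
by rewrite mulrnAr -[X in _ - X]scalerMnr -addrA -mulrnBl -hermS [RHS]mulrS.
Qed.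

Lemma size_herm n : size (herm n) = n.+1.
Proof.
elim: n => [|n IHn]; first by rewrite size_poly1.
have h0 : herm n != 0 by rewrite -size_poly_gt0 IHn.
have s1 : size (('X - c%:P) * herm n) = n.+2.
  by rewrite size_monicM ?monicXsubC // size_XsubC IHn.
rewrite hermS size_polyDl ?s1 // size_polyN ltnS.
by rewrite (leq_trans (size_scale_leq _ _)) // (leq_trans (ltnW (lt_size_deriv h0))) // IHn.
Qed.

Lemma herm_monic n : herm n \is monic.
Proof.
elim: n => [|n IHn]; first exact: monic1.
rewrite monicE hermS lead_coefDl ?lead_coefM ?lead_coefXsubC ?mul1r // size_polyN.
have h0 : herm n != 0 by rewrite -size_poly_gt0 size_herm.
rewrite size_monicM ?monicXsubC // size_XsubC size_herm ltnS.
by rewrite (leq_trans (size_scale_leq _ _)) // (leq_trans (ltnW (lt_size_deriv h0))) //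
  size_herm.
Qed.

Lemma herm_neq0 n : herm n != 0.
Proof. exact/monic_neq0/herm_monic. Qed.

(** Hermite's equation: by the Appell property, the left side for n + 1 is -2 (n + 1) times the
    recursion that defines H_(n+1). *)
Lemma herm_eigen n :
  (herm n)^`()^`() - ('X - c%:P) * (herm n)^`() *+ 2 = (- 2 * n%:R) *: herm n.
Proof.
case: n => [|n]; first by rewrite !derivC mulr0 mul0rn subr0 mulr0 scale0r.
rewrite deriv_herm derivMn /= [('X - _) * (_ *+ _)]mulrnAr; apply/polyP => i.
rewrite !(coefMn, coefB, coefZ); move: (_`_i) (_`_i) => u v.
by field.
Qed.

Lemma size_sub_lead_herm p : p != 0 ->
  (size (p - lead_coef p *: herm (size p).-1)%R < size p)%N.
Proof.
move=> p0; set m := (size p).-1.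
have mE : size p = m.+1 by rewrite prednK ?size_poly_gt0.
rewrite [in ltnRHS]mE ltnS; apply/leq_sizeP => i; rewrite leq_eqVlt => /predU1P[<-|lt_mi].
  rewrite coefB coefZ -/(lead_coef p).
  have := monicP (herm_monic m); rewrite /lead_coef size_herm /= => ->.
  by rewrite mulr1 subrr.
by rewrite coefB coefZ !nth_default ?mulr0 ?subr0 // ?mE ?size_herm.
Qed.

(** Subtracting the leading Hermite term lowers the degree, so linear statements need checking on
    the Hermite basis alone. *)
Lemma herm_ind (P : {poly K} -> Prop) :
  P 0 -> (forall p q, P p -> P q -> P (p + q)) ->
  (forall k p, P p -> P (k *: p)) -> (forall n, P (herm n)) -> forall p, P p.
Proof.
move=> P0 PD PZ Ph p; have [n] := ubnP (size p); elim: n p => // n IHn p lt_pn.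
have [->//|p0] := eqVneq p 0.
rewrite -[p](subrK (lead_coef p *: herm (size p).-1)); apply: PD; last exact: PZ.
by apply: IHn; exact: leq_trans (size_sub_lead_herm p0) lt_pn.
Qed.

Lemma size_herm_diag (phi : {linear {poly K} -> {poly K}}) (beta : nat -> K) :
  (forall n, phi (herm n) = beta n *: herm n) ->
  forall p, (size (phi p) <= size p)%N.
Proof.
move=> hphi p; have [n] := ubnP (size p); elim: n p => // n IHn p lt_pn.
have [->|p0] := eqVneq p 0; first by rewrite raddf0.
have lt := size_sub_lead_herm p0; set r := p - _ in lt.
have -> : p = r + lead_coef p *: herm (size p).-1 by rewrite subrK.
rewrite [in leqLHS]raddfD /= linearZ /= hphi (leq_trans (size_polyD _ _)) // geq_max.
rewrite subrK (leq_trans (IHn r (leq_trans lt lt_pn)) (ltnW lt)) /=.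
by rewrite scalerA (leq_trans (size_scale_leq _ _)) // size_herm prednK ?size_poly_gt0.
Qed.

End HermitePolynomials.

Arguments herm {K} c n : simpl never.

(* Up to a positive factor, the only such functional is the integral against
   exp (- x^2 + 2 c x): integration by parts turns p' into 2 (x - c) p. *)
Definition gauss_functional (K : numFieldType) (c : K) (L : {scalar {poly K}}) :=
  (forall p, L p^`() = 2 * L (('X - c%:P) * p)) /\ 0 < L 1.

(** * Orthogonality and adjoints for one Gaussian functional *)

Section GaussFunctional.
Variables (K : numFieldType) (c : K) (L : {scalar {poly K}}).
Hypothesis hL : gauss_functional c L.
Implicit Types p q r s : {poly K}.

Lemma gauss_ibp p q : L (p^`() * q) = 2 * L (('X - c%:P) * p * q) - L (p * q^`()).
Proof. by rewrite -mulrA -hL.1 derivM raddfD /= addrK. Qed.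

(** The adjoint of d/dx for L is 2 (X - c) - d/dx, twice the raising operator in the recursion of
    [herm]. Iterating this yields the Rodrigues formula [gauss_herm], from which orthogonality
    follows. *)
Lemma gauss_hermS n p : L (herm c n.+1 * p) = L (herm c n * p^`()) / 2.
Proof.
rewrite hermS mulrBl raddfB /= -scalerAl linearZ /= gauss_ibp.
by field.
Qed.

Lemma gauss_herm n p : L (herm c n * p) = L p^`(n) / 2 ^+ n.
Proof.
elim: n p => [|n IHn] p; first by rewrite mul1r expr0 divr1.
by rewrite gauss_hermS IHn -derivSn exprSr invfM mulrA.
Qed.

Definition herm_norm n := n`!%:R / 2 ^+ n * L 1.

Lemma herm_normS n : herm_norm n.+1 = n.+1%:R / 2 * herm_norm n.
Proof.
rewrite /herm_norm factS natrM exprS invfM.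
by move: (n`!%:R) (n.+1%:R) (2 ^+ n)^-1 (L 1) => x y z w; ring.
Qed.

Lemma herm_norm_gt0 n : 0 < herm_norm n.
Proof.
by rewrite mulr_gt0 ?hL.2 // divr_gt0 ?exprn_gt0 // ltr0n fact_gt0.
Qed.

Lemma herm_norm_neq0 n : herm_norm n != 0.
Proof. by rewrite gt_eqF ?herm_norm_gt0. Qed.

Lemma gauss_herm_small n p : (size p <= n)%N -> L (herm c n * p) = 0.
Proof. by move=> le_pn; rewrite gauss_herm derivn_poly0 // raddf0 mul0r. Qed.

Lemma gauss_herm_lead n p : (size p <= n.+1)%N ->
  L (herm c n * p) = p`_n * herm_norm n.
Proof.
move=> le_pn; rewrite gauss_herm.
have -> : p^`(n) = (p`_n * n`!%:R) *: 1.
  apply/polyP => i; rewrite coef_derivn coefZ coef1.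
  case: i => [|i]; first by rewrite addn0 ffactnn mulr1 mulr_natr.
  by rewrite nth_default ?mul0rn ?mulr0 // (leq_trans le_pn) // addnS ltnS leq_addr.
by rewrite linearZ /= /herm_norm; ring.
Qed.

Lemma gauss_herm_orth n m : L (herm c n * herm c m) = herm_norm n *+ (n == m).
Proof.
wlog le_mn : n m / (m <= n)%N.
  move=> W; have [/W//|lt_nm] := leqP m n.
  by rewrite mulrC W 1?ltnW // eq_sym; case: eqP => [->|].
rewrite gauss_herm_lead ?size_herm //; have [<-|ne] := eqVneq.
  by have := monicP (herm_monic c n); rewrite /lead_coef size_herm => ->; rewrite mul1r.
by rewrite nth_default ?mul0r // size_herm ltn_neqAle eq_sym ne.
Qed.

Lemma gauss_nondegenerate p : (forall q, L (q * p) = 0) -> p = 0.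
Proof.
move=> hp; apply/eqP; apply: contraT => p0.
have sp : size p = (size p).-1.+1 by rewrite prednK ?size_poly_gt0.
have /eqP := hp (herm c (size p).-1).
by rewrite gauss_herm_lead -?sp // mulf_eq0 (negPf (herm_norm_neq0 _)) orbF
  lead_coef_eq0 (negPf p0).
Qed.

(** Existence of a polynomial-valued adjoint for the form L (p q). Differential operators with
    polynomial coefficients have one, by integration by parts. *)
Definition adjointable (phi : {poly K} -> {poly K}) :=
  forall r, exists s, forall q, L (phi q * r) = L (q * s).

Lemma adjointable_derivn n : adjointable (derivn n).
Proof.
elim: n => [|n IHn] r; first by exists r.
have [s hs] := IHn (('X - c%:P) * r *+ 2 - r^`()).
exists s => q; rewrite derivnS gauss_ibp -hs mulrBr raddfB /=; congr (_ - _).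
by rewrite mulrnAr raddfMn /= mulr_natl mulrCA mulrA.
Qed.

Lemma adjointable_mulr phi p : adjointable phi -> adjointable (fun q => phi q * p).
Proof. by move=> h r; have [s hs] := h (p * r); exists s => q; rewrite -mulrA. Qed.

Lemma adjointable_sum I (e : seq I) (phi : I -> {poly K} -> {poly K}) :
  (forall i, adjointable (phi i)) -> adjointable (fun q => \sum_(i <- e) phi i q).
Proof.
move=> h r; elim: e => [|i e [s hs]].
  by exists 0 => q; rewrite big_nil mul0r mulr0.
have [t ht] := h i r; exists (t + s) => q.
by rewrite big_cons mulrDl mulrDr !raddfD /= hs ht.
Qed.

End GaussFunctional.

(** * Two Gaussian functionals with distinct centres *)

Section TwoGaussFunctionals.
Variables (K : numFieldType) (c d : K) (L M : {scalar {poly K}}).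
Hypotheses (hL : gauss_functional c L) (hM : gauss_functional d M).
Hypothesis ne_cd : c != d.
Implicit Types p q r s : {poly K}.

(* The algebraic form of the fact that s(x) exp (2 c x) = r(x) exp (2 d x)
   forces s = 0: differentiating s L = r M lowers the degree of s. *)
Lemma gauss_functional_indep s r :
  (forall q, L (q * s) = M (q * r)) -> s = 0.
Proof.
have [n] := ubnP (size s); elim: n s r => // n IHn s r lt_sn hsr.
have [//|s0] := eqVneq s 0.
(* Integration by parts on both sides turns the pair (s, r) into (s', r' + 2 (d - c) r), which
   satisfies the same relation. *)
have hd q : L (q * s^`()) = M (q * (r^`() + (2 * (d - c)) *: r)).
  have E1 := gauss_ibp hL q s; have E2 := gauss_ibp hM q r.
  have E3 := hsr ('X * q); have E4 := hsr q; have E5 := hsr q^`().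
  rewrite mulrDr raddfD /= -scalerAr linearZ /=.
  have EL : L (('X - c%:P) * q * s) = L ('X * q * s) - c * L (q * s).
    by rewrite 2!mulrBl raddfB /= -!mulrA mul_polyC linearZ.
  have EM : M (('X - d%:P) * q * r) = M ('X * q * r) - d * M (q * r).
    by rewrite 2!mulrBl raddfB /= -!mulrA mul_polyC linearZ.
  rewrite EL E3 E4 E5 in E1; rewrite EM in E2.
  have -> : L (q * s^`()) = 2 * (M ('X * q * r) - c * M (q * r)) - M (q^`() * r).
    by rewrite E1; ring.
  by rewrite E2; ring.
have ds0 : s^`() = 0.
  by apply: IHn hd; rewrite (leq_trans (lt_size_deriv s0)).
(* Once s' = 0, r' + 2 (d - c) r pairs to zero with everything; as c and d differ, its degree is
   that of r unless r = 0. *)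
have r0 : r = 0.
  have : r^`() + (2 * (d - c)) *: r = 0.
    by apply: (gauss_nondegenerate hM) => q; rewrite -hd ds0 mulr0 raddf0.
  apply: contra_eq => r0; rewrite -size_poly_gt0 addrC size_polyDl.
    by rewrite size_scale ?size_poly_gt0 // mulf_neq0 ?pnatr_eq0 ?subr_eq0 1?eq_sym.
  rewrite size_scale ?lt_size_deriv //.
  by rewrite mulf_neq0 ?pnatr_eq0 ?subr_eq0 1?eq_sym.
by apply: (gauss_nondegenerate hL) => q; rewrite hsr r0 mulr0 raddf0.
Qed.

(* The band condition makes q |-> L (phi q * r) of the form M (q * t), while
   adjointability makes it of the form L (q * s). *)
Lemma adjointable_band_eq0 (phi : {linear {poly K} -> {poly K}}) :
  adjointable L phi ->
  (forall r, exists N, forall m, (N <= m)%N -> L (phi (herm d m) * r) = 0) ->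
  forall p, phi p = 0.
Proof.
move=> adj band p; apply: (gauss_nondegenerate hL) => r; rewrite mulrC.
have [s hs] := adj r; have [N hN] := band r.
(* The polynomial representing q |-> L (phi q * r) through M: its Hermite coefficients are the
   values on H_k divided by the norms, and the band condition makes the sum finite. *)
pose t := \sum_(k < N) (L (phi (herm d k) * r) / herm_norm M k) *: herm d k.
suff s0 : s = 0 by rewrite hs s0 mulr0 raddf0.
apply: (@gauss_functional_indep s t); apply: (herm_ind (c := d)).
- by rewrite !mul0r !raddf0.
- by move=> q1 q2 h1 h2; rewrite !mulrDl !raddfD /= h1 h2.
- by move=> k q h; rewrite -!scalerAl !linearZ /= h.
move=> m; rewrite -hs mulr_sumr raddf_sum /=.
under eq_bigr => k _ do rewrite -scalerAr linearZ /= (gauss_herm_orth hM).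
have [lt_mN|le_Nm] := ltnP m N.
  rewrite (bigD1 (Ordinal lt_mN)) //= eqxx mulr1n divfK ?(herm_norm_neq0 hM) //.
  rewrite big1 ?addr0 // => k; rewrite -val_eqE /= eq_sym => /negPf ->.
  by rewrite mulr0n mulr0.
rewrite hN // big1 // => k _; rewrite gtn_eqF ?mulr0 //.
exact: leq_trans (ltn_ord k) _.
Qed.

End TwoGaussFunctionals.
(** * Scalar differential operators diagonal on Hermite polynomials *)

Section PolynomialSymbol.
Variable K : numFieldType.
Implicit Types p q : {poly K}.

Lemma coefM_top p q m n : (size p <= m.+1)%N -> (size q <= n.+1)%N ->
  (p * q)`_(m + n) = p`_m * q`_n.
Proof.
move=> hp hq; have lt_m : (m < (m + n).+1)%N by rewrite ltnS leq_addr.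
rewrite coefM (bigD1 (Ordinal lt_m)) //= addKn big1 ?addr0 // => i.
rewrite -val_eqE /= neq_ltn => /orP[lt_im|lt_mi].
  by rewrite [q`__]nth_default ?mulr0 // (leq_trans hq) //; lia.
by rewrite nth_default ?mul0r // (leq_trans hp).
Qed.

(** Testing on X^k isolates k! F_k: terms of order above k vanish, and those of order below k are
    bounded by induction. *)
Lemma size_coef_diffop N (F : nat -> {poly K}) :
  (forall p, size (\sum_(k < N) p^`(k) * F k)%R <= size p)%N ->
  forall k, (k < N)%N -> (size (F k) <= k.+1)%N.
Proof.
move=> hF; elim/ltn_ind => k IHk ltkN.
have := hF 'X^k; rewrite (bigD1 (Ordinal ltkN)) //= size_polyXn.
set S := \sum_(_ < _ | _) _ => hk.
have sS : (size S <= k.+1)%N.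
  apply: (big_ind (fun p : {poly K} => size p <= k.+1)%N) => [|p q hp hq|j].
  - by rewrite size_poly0.
  - by rewrite (leq_trans (size_polyD _ _)) // geq_max hp hq.
  rewrite -val_eqE /= neq_ltn => /orP[ltjk|ltkj].
    rewrite derivnXn (leq_trans (size_polyMleq _ _)) //.
    have h1 : (size (('X^(k - j) : {poly K}) *+ k ^_ j) <= (k - j).+1)%N.
      by rewrite -scaler_nat (leq_trans (size_scale_leq _ _)) // size_polyXn.
    have := leq_add h1 (IHk _ ltjk (ltn_ord j)).
    by rewrite addSn addnS subnK ?(ltnW ltjk) //; case: (_ + _)%N.
  by rewrite derivnXn ffact_small // mulr0n mul0r size_poly0.
have -> : F k = (k`!%:R)^-1 *: (('X^k)^`(k) * F k).
  rewrite derivnXn subnn expr0 ffactnn mulr_natl -scaler_nat scalerA mulVf ?scale1r //.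
rewrite (leq_trans (size_scale_leq _ _)) // -[_ * _](addrK S).
by rewrite (leq_trans (size_polyD _ _)) // geq_max hk size_polyN.
Qed.

(** The falling factorial in the variable -X/2, chosen because the Hermite eigenvalues are -2n. *)
Definition ffact_poly k : {poly K} := \prod_(i < k) ((- 2^-1) *: 'X - (i%:R)%:P).

Lemma horner_ffact_poly n k : (ffact_poly k).[- 2 * n%:R] = (n ^_ k)%:R.
Proof.
rewrite /ffact_poly horner_prod; elim: k => [|k IHk]; first by rewrite big_ord0.
rewrite big_ord_recr /= IHk ffactnSr natrM hornerD hornerN hornerZ hornerX hornerC.
have [le_kn|lt_nk] := leqP k n; last by rewrite ffact_small // !mul0r.
by rewrite natrB //; congr (_ * _); field.
Qed.

(** Since deg F_k <= k, only top coefficients reach degree n in the eigenvalue equation: beta_n is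
    the sum over k of the falling factorial of n times the coefficient of X^k in F_k. *)
Lemma diffop_eigenvalue_poly N (F : nat -> {poly K}) (c : K) (beta : nat -> K) :
  (forall p, size (\sum_(k < N) p^`(k) * F k)%R <= size p)%N ->
  (forall n, \sum_(k < N) (herm c n)^`(k) * F k = beta n *: herm c n) ->
  exists g : {poly K}, forall n, beta n = g.[- 2 * n%:R].
Proof.
move=> hF heig; have sF := size_coef_diffop hF.
exists (\sum_(k < N) (F k)`_k *: ffact_poly k) => n.
have hn : (herm c n)`_n = 1.
  by have := monicP (herm_monic c n); rewrite /lead_coef size_herm.
have -> : beta n = (beta n *: herm c n)`_n by rewrite coefZ hn mulr1.
rewrite -heig coef_sum horner_sum; apply: eq_bigr => k _.
rewrite hornerZ horner_ffact_poly; have [le_kn|lt_nk] := leqP k n; last first.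
  by rewrite ffact_small // mulr0 derivn_poly0 ?mul0r ?coef0 // size_herm.
rewrite -[X in _`_X](subnK le_kn) coefM_top ?sF //.
  by rewrite coef_derivn subnKC // hn mulrC.
apply/leq_sizeP => i; rewrite coef_derivn => lt_i.
by rewrite nth_default ?mul0rn // size_herm; lia.
Qed.

End PolynomialSymbol.

(** * Rigidity: vanishing off-diagonal entries and linked eigenvalues *)

Section ScalarMul.
Variables (K : numFieldType) (L : {scalar {poly K}}).
Implicit Types p q r : {poly K}.

Lemma scalarDl p q r : L ((p + q) * r) = L (p * r) + L (q * r).
Proof. by rewrite mulrDl raddfD. Qed.

Lemma scalarNl p r : L (- p * r) = - L (p * r).
Proof. by rewrite mulNr raddfN. Qed.

Lemma scalarZl k p r : L (k *: p * r) = k * L (p * r).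
Proof. by rewrite -scalerAl linearZ. Qed.

End ScalarMul.

(* The hypothesis [hf] spells out the entries of (P_n T) (T^-1 E T) =
   Lambda (P_n T) for P_n T = [[H_n, a h_(n+1)], [- tau H_n', h_n]]. *)
Section Rigidity.
Variables (K : numFieldType) (a b tau : K) (L0 Lb : {scalar {poly K}}).
Hypotheses (hL0 : gauss_functional 0 L0) (hLb : gauss_functional b Lb).
Hypotheses (a0 : a != 0) (b0 : b != 0) (tau0 : forall n : nat, 1 + a * tau * n%:R != 0).
Variables f00 f01 f10 f11 : {linear {poly K} -> {poly K}}.
Hypotheses (adj01 : adjointable L0 f01) (adj10 : adjointable Lb f10).
Local Notation H := (herm b).
Local Notation h := (herm 0).
Hypothesis hf : forall n, exists l00 l01 l10 l11,
  [/\ f00 (H n) + a *: f10 (h n.+1) = l00 *: H n - (l01 * tau) *: (H n)^`(),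
      f01 (H n) + a *: f11 (h n.+1) = (l00 * a) *: h n.+1 + l01 *: h n,
      - (tau *: f00 (H n)^`()) + f10 (h n) = l10 *: H n - (l11 * tau) *: (H n)^`()
    & - (tau *: f01 (H n)^`()) + f11 (h n) = (l10 * a) *: h n.+1 + l11 *: h n].

(** Eliminating f00 (H_n) between the first relation at n and the third at n + 1 puts (1 + a tau (n
    + 1)) f10 (h_(n+1)) in the span of H_(n+1), H_n and H_(n-1). This is the band condition of
    [adjointable_band_eq0]. *)
Lemma offdiag10_eq0 p : f10 p = 0.
Proof.
apply: (adjointable_band_eq0 hLb hL0 b0 adj10) => r.
(* The index is n + 1 here, so the margin 2 gives [size r <= n.-1] and makes even H_(n-1) orthogonal
   to [r]. *)
exists (size r).+2 => -[//|n] lt_rn.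
have [l00 [l01 [_ [_ [E1 _ _ _]]]]] := hf n.
have [_ [_ [l10 [l11 [_ _ E3 _]]]]] := hf n.+1.
have {E1}E1 : f00 (H n) = l00 *: H n - (l01 * tau) *: (H n)^`() - a *: f10 (h n.+1).
  by rewrite -E1 addrK.
have /(congr1 (fun q => Lb (q * r))) : (1 + a * tau * n.+1%:R) *: f10 (h n.+1) =
  l10 *: H n.+1 - (l11 * tau * n.+1%:R) *: H n
  + (tau * n.+1%:R) *: (l00 *: H n - (l01 * tau * n%:R) *: H n.-1).
  move: E3; rewrite deriv_herm /= raddfMn /= E1 deriv_herm.
  rewrite -!(scaler_nat n.+1) -!(scaler_nat n).
  move=> E3; apply/polyP => i; move: (congr1 (fun q : {poly K} => q`_i) E3).
  move/eqP; rewrite -subr_eq0 => /eqP E; apply: subr0_eq; apply: etrans E.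
  by rewrite !(coefD, coefB, coefN, coefZ); ring.
have {}lt_rn : (size r <= n.-1)%N by move: (lt_rn); case: (n).
have := gauss_herm_small hLb lt_rn.
have := gauss_herm_small hLb (leq_trans lt_rn (leq_pred n)).
have := gauss_herm_small hLb (leqW (leq_trans lt_rn (leq_pred n))).
move: (f10 _) (H n.+1) (H n) (H n.-1) => F A B C EA EB EC.
rewrite !(scalarDl, scalarNl, scalarZl, scalerDr, scalerN).
rewrite EA EB EC !(mulr0, oppr0, addr0).
by move/eqP; rewrite mulf_eq0 (negPf (tau0 _)) => /eqP.
Qed.

(** The same elimination with f11 (h_(n+1)), between the second relation at n and the fourth at n +
    1, puts f01 (H_n) in the span of h_n, h_(n+1) and h_(n+2). *)
Lemma offdiag01_eq0 p : f01 p = 0.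
Proof.
apply: (adjointable_band_eq0 hL0 hLb _ adj01); first by rewrite eq_sym.
move=> r; exists (size r) => n lt_rn.
have [l00 [l01 [_ [_ [_ E2 _ _]]]]] := hf n.
have [_ [_ [l10 [l11 [_ _ _ E4]]]]] := hf n.+1.
have /(congr1 (fun q => L0 (q * r))) : (1 + a * tau * n.+1%:R) *: f01 (H n) =
  (l00 * a) *: h n.+1 + l01 *: h n - a *: ((l10 * a) *: h n.+2 + l11 *: h n.+1).
  rewrite -E2 -E4 deriv_herm raddfMn /= -(scaler_nat n.+1).
  by apply/polyP => i; rewrite !(coefD, coefB, coefN, coefZ); ring.
have := gauss_herm_small hL0 lt_rn.
have := gauss_herm_small hL0 (leqW lt_rn).
have := gauss_herm_small hL0 (leqW (leqW lt_rn)).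
move: (f01 _) (h n.+2) (h n.+1) (h n) => F A B C EA EB EC.
rewrite !(scalarDl, scalarNl, scalarZl, scalerDr, scalerN).
rewrite EA EB EC !(mulr0, oppr0, addr0).
by move/eqP; rewrite mulf_eq0 (negPf (tau0 _)) => /eqP.
Qed.

Lemma herm_eq0_3 n (u v w : K) :
  u *: h n.+2 + v *: h n.+1 + w *: h n = 0 -> [/\ u = 0, v = 0 & w = 0].
Proof.
move=> E; have N0 k := herm_norm_neq0 hL0 k.
have EL k : L0 ((u *: h n.+2 + v *: h n.+1 + w *: h n) * h k) = 0.
  by rewrite E mul0r raddf0.
have {}EL k : u * (herm_norm L0 n.+2 *+ (n.+2 == k))
   + v * (herm_norm L0 n.+1 *+ (n.+1 == k)) + w * (herm_norm L0 n *+ (n == k)) = 0.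
  rewrite -(EL k) -!(gauss_herm_orth hL0).
  move: (h n.+2) (h n.+1) (h n) => A B C.
  by rewrite !(scalarDl, scalarZl).
split; [have := EL n.+2 | have := EL n.+1 | have := EL n];
  rewrite ?eqxx ?(gtn_eqF (leqnn _)) ?(ltn_eqF (leqnn _))
    ?(gtn_eqF (leqW (leqnn _))) ?(ltn_eqF (leqW (leqnn _))) ?mulr0n ?mulr0 ?addr0 ?add0r
    ?mulr1n => /eqP; by rewrite mulf_eq0 (negPf (N0 _)) orbF => /eqP.
Qed.

(** With the off-diagonal entries gone, f11 (h_(n+1)) is expressed twice, by the second relation at
    n and the fourth at n + 1. Comparing Hermite coefficients kills the off-diagonal multipliers and
    shows that H_n and h_(n+1) share their eigenvalue. *)
Lemma diag_eigen : exists beta : nat -> K,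
  (forall n, f11 (h n) = beta n *: h n) /\ (forall n, f00 (H n) = beta n.+1 *: H n).
Proof.
have key n : exists l00 l11, [/\ f00 (H n) = l00 *: H n, f11 (h n.+1) = l00 *: h n.+1 
    & f11 (h n) = l11 *: h n].
  have [l00 [l01 [l10 [l11 [E1 E2 E3 E4]]]]] := hf n.
  have [m00 [m01 [m10 [m11 [_ _ _ F4]]]]] := hf n.+1.
  rewrite offdiag10_eq0 scaler0 addr0 in E1; rewrite offdiag01_eq0 add0r in E2.
  rewrite offdiag01_eq0 scaler0 oppr0 add0r in E4.
  rewrite offdiag01_eq0 scaler0 oppr0 add0r in F4.
  have [m10_0 m11E l01_0] : [/\ a * m10 * a = 0, a * m11 - l00 * a = 0 & - l01 = 0].
    apply: (@herm_eq0_3 n); transitivity (a *: f11 (h n.+1) - a *: f11 (h n.+1)).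
      by rewrite {1}F4 E2; apply/polyP => i; rewrite !(coefD, coefB, coefN, coefZ); ring.
    exact: subrr.
  move/eqP: l01_0; rewrite oppr_eq0 => /eqP l01_0.
  have E2' : f11 (h n.+1) = l00 *: h n.+1.
    apply: (scalerI a0); rewrite E2 l01_0 scale0r addr0 scalerA mulrC //.
  (* For n = 0 the third relation reads 0 = l10 H_0; for positive n the comparison is made one index
     lower. *)
  have l10_0 : l10 = 0.
    case: n {E1 E2 F4 m11E E2'} E3 E4 => [|n] E3 E4.
      move: E3; rewrite herm0 derivC raddf0 offdiag10_eq0 !scaler0 oppr0 !addr0 => /eqP.
      by rewrite eq_sym scaler_eq0 oner_eq0 orbF => /eqP.
    have [k00 [k01 [_ [_ [_ G2 _ _]]]]] := hf n.
    rewrite offdiag01_eq0 add0r in G2.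
    have [/eqP + _ _] : [/\ a * l10 * a = 0, a * l11 - k00 * a = 0 & - k01 = 0].
      apply: (@herm_eq0_3 n); transitivity (a *: f11 (h n.+1) - a *: f11 (h n.+1)).
        by rewrite {1}E4 G2; apply/polyP => i; rewrite !(coefD, coefB, coefN, coefZ); ring.
      exact: subrr.
    by rewrite !mulf_eq0 (negPf a0) orbF => /eqP.
  exists l00, l11; split => //; first by rewrite E1 l01_0 mul0r scale0r subr0.
  by rewrite E4 l10_0 mul0r scale0r add0r.
have [g hg] := boolp.choice key.
have [g' hg'] := boolp.choice hg.
(* [g m] is the common eigenvalue of H_m and h_(m+1); only h_0 has no such partner and takes its own
   eigenvalue. *)
exists (fun n => if n is m.+1 then g m else g' 0%N); split=> -[|n] /=.
- by have [] := hg' 0%N.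
- by have [] := hg' n.
- by have [] := hg' 0%N.
- by have [] := hg' n.+1.
Qed.

End Rigidity.
(** * Matrix differential operators *)

Section OperatorEntries.
Variable K : numFieldType.
Local Notation M := ('M[{poly K}]_2).
Implicit Types (P : M) (D E : diffop K) (p q : {poly K}).

Definition dop_entry E i j q : {poly K} :=
  \sum_(k < size (dop_coef E)) q^`(k) * (dop_coef E)`_k i j.

Lemma dop_entry_is_linear E i j : linear (dop_entry E i j).
Proof.
move=> k p q; rewrite /dop_entry scaler_sumr -big_split; apply: eq_bigr => l _ /=.
by rewrite derivnD derivnZ mulrDl scalerAl.
Qed.

HB.instance Definition _ E i j :=
  GRing.isLinear.Build K {poly K} {poly K} *:%R (dop_entry E i j)
    (dop_entry_is_linear E i j).

Lemma dop_act_entry P E i j : dop_act P E i j = \sum_l dop_entry E l j (P i l).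
Proof.
rewrite /dop_act summxE exchange_big; apply: eq_bigr => k _.
by rewrite mxE; apply: eq_bigr => l _; rewrite mxE.
Qed.

Lemma adjointable_dop_entry c (L : {scalar {poly K}}) E i j :
  gauss_functional c L -> adjointable L (dop_entry E i j).
Proof.
by move=> hL; apply: adjointable_sum => k; apply/adjointable_mulr/(adjointable_derivn hL).
Qed.

Lemma dop_act_mul P D E : dop_act P (D * E) = dop_act (dop_act P D) E.
Proof. exact: dop_actM. Qed.

Lemma dop_act_one P : dop_act P 1 = P.
Proof. by rewrite -[1]/(dop_mx 1) dop_act_mx mulmx1. Qed.

Lemma dop_act_constM (A : 'M[K]_2) P E :
  dop_act (map_mx polyC A *m P) E = map_mx polyC A *m dop_act P E.
Proof.
rewrite /dop_act mulmx_sumr; apply: eq_bigr => k _; rewrite mulmxA; congr (_ *m _).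
apply/matrixP => i j; rewrite !mxE raddf_sum; apply: eq_bigr => l _ /=.
by rewrite !mxE !mul_polyC derivnZ.
Qed.

Lemma dop_act_horner P D (c : K) (g : {poly K}) :
  dop_act P D = c%:P *: P -> dop_act P (horner_alg D g) = (g.[c])%:P *: P.
Proof.
move=> hP; elim/poly_ind: g => [|g k IHg].
  by rewrite rmorph0 horner0 scale0r dop_act0r.
rewrite rmorphD rmorphM /= horner_algX horner_algC dop_actDr dop_act_mul IHg.
rewrite dop_actZl hP dop_actZr dop_act_one scalerA -scalerDl.
by rewrite -polyCM -polyCD hornerMXaddC.
Qed.

End OperatorEntries.

(** * Two-by-two matrices *)

Section TwoByTwo.

Lemma eq_mx22 (T : Type) (A B : 'M[T]_2) :
  A 0 0 = B 0 0 -> A 0 1 = B 0 1 -> A 1 0 = B 1 0 -> A 1 1 = B 1 1 -> A = B.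
Proof.
move=> h00 h01 h10 h11; apply/matrixP => i j.
have o2 (k : 'I_2) : k = 0 \/ k = 1.
  by case: k => -[|[|//]] hk; [left | right]; apply: val_inj.
by have [-> | ->] := o2 i; have [-> | ->] := o2 j.
Qed.

Lemma mulmx2E (K : pzSemiRingType) (A B : 'M[K]_2) i j :
  (A *m B) i j = A i 0 * B 0 j + A i 1 * B 1 j.
Proof.
by rewrite mxE big_ord_recl big_ord1; congr (_ + A _ _ * B _ _); exact: val_inj.
Qed.

Lemma mulmx22 (K : pzSemiRingType) (a b c d a' b' c' d' : K) :
  mx22 a b c d *m mx22 a' b' c' d' =
  mx22 (a * a' + b * c') (a * b' + b * d') (c * a' + d * c') (c * b' + d * d').
Proof. by apply: eq_mx22; rewrite mulmx2E !mxE. Qed.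

Lemma addmx22 (V : nmodType) (a b c d a' b' c' d' : V) :
  mx22 a b c d + mx22 a' b' c' d' = mx22 (a + a') (b + b') (c + c') (d + d').
Proof. by apply: eq_mx22; rewrite !mxE. Qed.

Lemma mxderiv_mx22 (K : nzRingType) (a b c d : {poly K}) :
  mxderiv (mx22 a b c d) = mx22 a^`() b^`() c^`() d^`().
Proof. by apply: eq_mx22; rewrite !mxE. Qed.

End TwoByTwo.

(** * Conjugation of operators by T *)

Section Conjugation.
Variables (K : numFieldType) (a : K).
Local Notation M := ('M[{poly K}]_2).
Implicit Types (P : M) (D E : diffop K) (p q : {poly K}).

Definition Tmx : M := mx22 1 (a *: 'X) 0 1.
Definition Tinv : M := mx22 1 (- (a *: 'X)) 0 1.

Lemma TmxK : Tmx *m Tinv = 1%:M.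
Proof. by apply: eq_mx22; rewrite mulmx2E !mxE /=; ring. Qed.

Lemma TinvK : Tinv *m Tmx = 1%:M.
Proof. by apply: eq_mx22; rewrite mulmx2E !mxE /=; ring. Qed.

Lemma hermite_operator_row b p q : let u := p * - (a *: 'X) + q * 1 in
  u^`()^`() + (p^`() * (- (2 * a * b)%:P * 'X + (2 * a)%:P) + u^`() * (- 2%:P * 'X))
    + (p * 0 + u * 0) =
  (p^`()^`() - ('X - b%:P) * p^`() *+ 2 - p *+ 2) * - (a *: 'X)
    + (q^`()^`() - ('X - 0%:P) * q^`() *+ 2) * 1.
Proof.
move=> u; rewrite /u -!mul_polyC.
rewrite !(mulr1, mulrN, derivD, derivN, derivM, derivX, derivC, mul0r, add0r, addr0).
rewrite !polyCM polyC0 !polyC_natr.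
move: p^`()^`() p^`() q^`()^`() q^`() a%:P b%:P 'X => p2 p1 q2 q1 A B X; ring.
Qed.

(** Conjugation by T decouples the two columns: the first carries the Hermite operator centred at b,
    shifted by -2, and the second the one centred at 0. *)
Lemma hermite_operator_act b p q r s : let P := mx22 p q r s *m Tinv in
  mxderiv (mxderiv P)
  + mxderiv P *m mx22 (- 2%:P * 'X + (2 * b)%:P) (- (2 * a * b)%:P * 'X + (2 * a)%:P)
      0 (- 2%:P * 'X)
  + P *m mx22 (- 2%:P) 0 0 0 =
  mx22 (p^`()^`() - ('X - b%:P) * p^`() *+ 2 - p *+ 2)
       (q^`()^`() - ('X - 0%:P) * q^`() *+ 2)
       (r^`()^`() - ('X - b%:P) * r^`() *+ 2 - r *+ 2)
       (s^`()^`() - ('X - 0%:P) * s^`() *+ 2) *m Tinv.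
Proof.
rewrite /= /Tinv !mulmx22 !mxderiv_mx22 !mulmx22 !addmx22.
have e1 (v : {poly K}) w : (v * 1 + w * 0)^`()^`() +
    ((v * 1 + w * 0)^`() * (- 2%:P * 'X + (2 * b)%:P) + (v * - (a *: 'X) + w * 1)^`() * 0)
    + ((v * 1 + w * 0) * - 2%:P + (v * - (a *: 'X) + w * 1) * 0)
    = (v^`()^`() - ('X - b%:P) * v^`() *+ 2 - v *+ 2) * 1
      + (w^`()^`() - ('X - 0%:P) * w^`() *+ 2) * 0.
  rewrite !(mulr1, mulr0, addr0) polyCM !polyC_natr.
  move: v^`()^`() v^`() b%:P 'X => v2 v1 B X; ring.
congr mx22; rewrite ?e1 //.
  by rewrite -hermite_operator_row /= !(mulr1, mulr0, addr0).
by rewrite -hermite_operator_row /= !(mulr1, mulr0, addr0).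
Qed.

(** Operators act on the right, so a product applies its left factor first: this one sends P to ((P
    T^-1) E) T. *)
Definition dop_conj E : diffop K := dop_mx Tinv * E * dop_mx Tmx.

Lemma dop_act_conj P E : dop_act P (dop_conj E) = dop_act (P *m Tinv) E *m Tmx.
Proof. by rewrite !dop_act_mul !dop_act_mx. Qed.

Lemma dop_conj_eq0 E : dop_conj E = 0 -> E = 0.
Proof.
move=> E0; apply: dop_act_eq0 => P; have := dop_act_conj (P *m Tmx) E.
rewrite E0 dop_act0r -mulmxA TmxK mulmx1 => /(congr1 (mulmx^~ Tinv)).
by rewrite mul0mx -mulmxA TmxK mulmx1.
Qed.

(** The action is row by row, so row vectors determine the scalar entries of T^-1 E T, and each
    entry is determined on a Hermite basis, whose centre may depend on the column. *)
Lemma dop_herm_eq0 E b d :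
  (forall n, dop_act (mx22 (herm b n) 0 0 0 *m Tinv) E = 0) ->
  (forall n, dop_act (mx22 0 (herm d n) 0 0 *m Tinv) E = 0) -> E = 0.
Proof.
move=> hb hd; apply: dop_conj_eq0.
have entry0 (c : K) l : (forall n, dop_act ((if l == 0 then mx22 (herm c n) 0 0 0
     else mx22 0 (herm c n) 0 0) *m Tinv) E = 0) ->
   forall j p, dop_entry (dop_conj E) l j p = 0.
  move=> h j; apply: (herm_ind (c := c)).
  - by rewrite raddf0.
  - by move=> p q hp hq; rewrite raddfD /= hp hq addr0.
  - by move=> k p hp; rewrite linearZ /= hp scaler0.
  move=> n; have := dop_act_conj (if l == 0 then mx22 (herm c n) 0 0 0
     else mx22 0 (herm c n) 0 0) E.
  rewrite h mul0mx => /matrixP/(_ 0 j); rewrite dop_act_entry mxE.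
  rewrite big_ord_recl big_ord1; case: l {h} => -[|[|//]] hl.
    rewrite !mxE /= raddf0 addr0 => <-; congr dop_entry; exact: val_inj.
  rewrite !mxE /= raddf0 add0r => <-; congr dop_entry; exact: val_inj.
apply: dop_act_eq0 => P; apply/matrixP => i j; rewrite dop_act_entry mxE.
rewrite big_ord_recl big_ord1 (entry0 b) ?(entry0 d) ?addr0 //.
Qed.

End Conjugation.
(** * Complex Gaussian moments *)

Section ComplexMoments.
Variable R : realType.
Local Notation C := R[i].
Local Open Scope complex_scope.
Implicit Types (p q u v : {poly C}) (c d x : R).
Local Notation mu := (@lebesgue_measure R).
Local Notation re_poly := (map_poly (@complex.Re R)).
Local Notation im_poly := (map_poly (@complex.Im R)).

Lemma ReD (z w : C) : complex.Re (z + w) = complex.Re z + complex.Re w.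
Proof. by case: z w => [? ?] []. Qed.

Lemma ImD (z w : C) : complex.Im (z + w) = complex.Im z + complex.Im w.
Proof. by case: z w => [? ?] []. Qed.

Lemma ReMn (z : C) n : complex.Re (z *+ n) = complex.Re z *+ n.
Proof. by elim: n => // n IHn; rewrite !mulrS ReD IHn. Qed.

Lemma ImMn (z : C) n : complex.Im (z *+ n) = complex.Im z *+ n.
Proof. by elim: n => // n IHn; rewrite !mulrS ImD IHn. Qed.

Lemma ReM (z w : C) :
  complex.Re (z * w) = complex.Re z * complex.Re w - complex.Im z * complex.Im w.
Proof. by case: z w => [? ?] []. Qed.

Lemma ImM (z w : C) :
  complex.Im (z * w) = complex.Re z * complex.Im w + complex.Im z * complex.Re w.
Proof. by case: z w => [? ?] []. Qed.

Lemma coef_re_poly p i : (re_poly p)`_i = complex.Re p`_i.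
Proof. by rewrite coef_map_id0. Qed.

Lemma coef_im_poly p i : (im_poly p)`_i = complex.Im p`_i.
Proof. by rewrite coef_map_id0. Qed.

Lemma re_polyD p q : re_poly (p + q) = re_poly p + re_poly q.
Proof. by apply/polyP => i; rewrite coefD !coef_re_poly coefD ReD. Qed.

Lemma im_polyD p q : im_poly (p + q) = im_poly p + im_poly q.
Proof. by apply/polyP => i; rewrite coefD !coef_im_poly coefD ImD. Qed.

Lemma re_polyZ (k : C) p :
  re_poly (k *: p) = complex.Re k *: re_poly p - complex.Im k *: im_poly p.
Proof.
by apply/polyP => i; rewrite coefB !coefZ !coef_re_poly coef_im_poly coefZ ReM.
Qed.

Lemma im_polyZ (k : C) p :
  im_poly (k *: p) = complex.Re k *: im_poly p + complex.Im k *: re_poly p.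
Proof.
by apply/polyP => i; rewrite coefD !coefZ !coef_im_poly coef_re_poly coefZ ImM.
Qed.

Lemma re_poly_deriv p : re_poly p^`() = (re_poly p)^`().
Proof. by apply/polyP => i; rewrite coef_re_poly !coef_deriv coef_re_poly ReMn. Qed.

Lemma im_poly_deriv p : im_poly p^`() = (im_poly p)^`().
Proof. by apply/polyP => i; rewrite coef_im_poly !coef_deriv coef_im_poly ImMn. Qed.

Lemma re_poly_XsubCM c p : re_poly (('X - c%:C%:P) * p) = ('X - c%:P) * re_poly p.
Proof.
apply/polyP => i; rewrite coef_re_poly !mulrBl !coefB !coefXM !coefCM !coef_re_poly.
by rewrite ReD; case: (p`_i) => x y; case: (i) => [|n] /=; rewrite !(mul0r, subr0).
Qed.

Lemma im_poly_XsubCM c p : im_poly (('X - c%:C%:P) * p) = ('X - c%:P) * im_poly p.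
Proof.
apply/polyP => i; rewrite coef_im_poly !mulrBl !coefB !coefXM !coefCM !coef_im_poly.
by rewrite ImD; case: (p`_i) => x y; case: (i) => [|n] /=; rewrite !(mul0r, addr0).
Qed.

Lemma Re_horner p x : complex.Re p.[x%:C] = (re_poly p).[x].
Proof.
elim/poly_ind: p => [|p k IHp].
  rewrite (_ : re_poly 0 = 0) ?horner0 //.
  by apply/polyP => i; rewrite coef_re_poly !coef0.
have -> : re_poly (p * 'X + k%:P) = re_poly p * 'X + (complex.Re k)%:P.
  apply/polyP => i; rewrite coef_re_poly !coefD !coefMX !coefC ReD coef_re_poly.
  by case: (i).
rewrite !hornerMXaddC ReD -IHp; case: (p.[_]) => u v /=.
by rewrite mulr0 subr0.
Qed.

Lemma Im_horner p x : complex.Im p.[x%:C] = (im_poly p).[x].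
Proof.
elim/poly_ind: p => [|p k IHp].
  rewrite (_ : im_poly 0 = 0) ?horner0 //.
  by apply/polyP => i; rewrite coef_im_poly !coef0.
have -> : im_poly (p * 'X + k%:P) = im_poly p * 'X + (complex.Im k)%:P.
  apply/polyP => i; rewrite coef_im_poly !coefD !coefMX !coefC ImD coef_im_poly.
  by case: (i).
rewrite !hornerMXaddC ImD -IHp; case: (p.[_]) => u v /=.
by rewrite mulr0 add0r.
Qed.

(** The weight is real, so the complex integral splits into two real moments, and the real results
    carry over to complex coefficients. *)
Definition cmoment c p : C :=
  gauss_moment c (re_poly p) +i* gauss_moment c (im_poly p).

Lemma cmoment_is_scalar c : scalar (cmoment c).
Proof.
move=> k p q; rewrite /cmoment re_polyD im_polyD re_polyZ im_polyZ -scaleNr.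
rewrite !gauss_momentD !gauss_momentZ.
by case: k => x y; apply/eqP; rewrite eq_complex /= !mulNr !eqxx.
Qed.

HB.instance Definition _ c :=
  GRing.isLinear.Build C {poly C} C^o *%R (cmoment c) (cmoment_is_scalar c).

Lemma cmoment_gauss c : gauss_functional c%:C (cmoment c).
Proof.
split=> [p|].
  have h r : gauss_moment c r^`() = 2 * gauss_moment c (('X - c%:P) * r).
    have := gauss_moment_ibp c r; rewrite -scaleN1r gauss_momentD gauss_momentZ.
    rewrite -scaler_nat gauss_momentZ mulN1r => /eqP; rewrite subr_eq0 => /eqP -> //.
  rewrite /= /cmoment re_poly_deriv im_poly_deriv re_poly_XsubCM im_poly_XsubCM !h.
  by apply/eqP; rewrite eq_complex /= !(mul0r, addr0, subr0) !eqxx.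
have re1 : re_poly 1 = 1.
  by apply/polyP => i; rewrite coef_re_poly !coef1; case: (i).
have im1 : im_poly 1 = 0 *: 1.
  by apply/polyP => i; rewrite coef_im_poly scale0r coef0 coef1; case: (i).
by rewrite /= /cmoment re1 im1 gauss_momentZ mul0r ltcR gauss_moment_gt0.
Qed.

Lemma cintegral_gauss c d u v :
  cintegral (fun x => u.[x%:C] * (gauss_weight c x)%:C + v.[x%:C] * (gauss_weight d x)%:C)
  = cmoment c u + cmoment d v.
Proof.
rewrite /cintegral /cmoment; apply/eqP; rewrite eq_complex /=; apply/andP; split.
  rewrite -RintegralD //; try exact: integrable_gauss_weight.
  apply/eqP/eq_Rintegral => x _; rewrite -!Re_horner ReD.
  by case: (u.[_]) (v.[_]) => [? ?] [? ?] /=; rewrite !mulr0 !subr0.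
rewrite -RintegralD //; try exact: integrable_gauss_weight.
apply/eqP/eq_Rintegral => x _; rewrite -!Im_horner ImD.
by case: (u.[_]) (v.[_]) => [? ?] [? ?] /=; rewrite !mulr0 !add0r.
Qed.

End ComplexMoments.
(** * The algebra of the weight *)

Section HermiteTypeWeight.
Variables (R : realType) (a b : R).
Local Notation C := R[i].
Local Open Scope complex_scope.
Local Notation M := ('M[{poly C}]_2).
Variables (L0 Lb : {scalar {poly C}}).
Hypotheses (hL0 : gauss_functional 0 L0) (hLb : gauss_functional b%:C Lb).
Variable W : R -> 'M[C]_2.
Local Notation D := (D_ex a b).
Local Notation H := (herm b%:C).
Local Notation h := (herm (0 : C)).
Local Notation T := (Tmx a%:C).
Local Notation Ti := (Tinv a%:C).
Local Notation conj_poly := (map_poly (@Num.conj C)).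
Implicit Types (P Q : M) (E : diffop C) (p q r s : {poly C}).

Definition wform P Q i j : C :=
  Lb ((P *m T) i 0 * conj_poly ((Q *m T) j 0)) +
  L0 ((P *m T) i 1 * conj_poly ((Q *m T) j 1)).

Hypothesis mxinner_W : forall P Q, mxinner W P Q = \matrix_(i, j) wform P Q i j.

Lemma wformDl P P' Q i j : wform (P + P') Q i j = wform P Q i j + wform P' Q i j.
Proof.
have e (X Y : M) k l : (X + Y) k l = X k l + Y k l by rewrite mxE.
by rewrite /wform mulmxDl !e !scalarDl addrACA.
Qed.

Lemma wformMl (A : 'M[C]_2) P Q i j : wform (map_mx polyC A *m P) Q i j =
  A i 0 * wform P Q 0 j + A i 1 * wform P Q 1 j.
Proof.
have e (k l : 'I_2) : map_mx polyC A k l = (A k l)%:P by rewrite mxE.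
rewrite /wform -mulmxA; move: (P *m T) (Q *m T) => X Y.
by rewrite !mulmx2E !e !mul_polyC !(scalarDl, scalarZl); ring.
Qed.

Lemma wformMr (A : 'M[C]_2) P Q i j : wform P (map_mx polyC A *m Q) i j =
  wform P Q i 0 * Num.conj (A j 0) + wform P Q i 1 * Num.conj (A j 1).
Proof.
have e (k l : 'I_2) : map_mx polyC A k l = (A k l)%:P by rewrite mxE.
rewrite /wform -mulmxA; move: (P *m T) (Q *m T) => X Y.
rewrite !mulmx2E !e !mul_polyC !rmorphD /= !map_polyZ /=.
rewrite ![_ * (_ + _)]mulrC !(scalarDl, scalarZl) ![conj_poly _ * _]mulrC; ring.
Qed.

Lemma mxinnerDl P P' Q : mxinner W (P + P') Q = mxinner W P Q + mxinner W P' Q.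
Proof. by rewrite !mxinner_W; apply/matrixP => i j; rewrite !mxE wformDl. Qed.

Lemma mxinnerMl (A : 'M[C]_2) P Q :
  mxinner W (map_mx polyC A *m P) Q = A *m mxinner W P Q.
Proof.
by rewrite !mxinner_W; apply/matrixP => i j; rewrite mulmx2E !mxE wformMl.
Qed.

Lemma mxinnerMr (A : 'M[C]_2) P Q :
  mxinner W P (map_mx polyC A *m Q) = mxinner W P Q *m adjmx A.
Proof.
by rewrite !mxinner_W; apply/matrixP => i j; rewrite mulmx2E !mxE wformMr.
Qed.

Lemma D_ex_act p q r s : dop_act (mx22 p q r s *m Ti) D =
  mx22 (p^`()^`() - ('X - b%:C%:P) * p^`() *+ 2 - p *+ 2)
       (q^`()^`() - ('X - 0%:P) * q^`() *+ 2)
       (r^`()^`() - ('X - b%:C%:P) * r^`() *+ 2 - r *+ 2)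
       (s^`()^`() - ('X - 0%:P) * s^`() *+ 2) *m Ti.
Proof.
rewrite /D_ex !dop_actDr expr2 !dop_act_mul !dop_act_mx !dop_act_d mulmx1.
exact: hermite_operator_act.
Qed.


(** * Monic matrix polynomials: expansion and uniqueness *)

Lemma coefp_constM (A : 'M[C]_2) P k :
  map_mx (coefp k) (map_mx polyC A *m P) = A *m map_mx (coefp k) P.
Proof.
apply/matrixP => i j; rewrite [LHS]mxE !mulmx2E !mxE /=.
by rewrite coefD !coefCM.
Qed.

Lemma mx_coefP P Q : (forall k, map_mx (coefp k) P = map_mx (coefp k) Q) -> P = Q.
Proof.
move=> PQ; apply/matrixP => i j; apply/polyP => k.
by have /matrixP/(_ i j) := PQ k; rewrite !mxE.
Qed.

(** As P_k has leading coefficient I, a left multiple of it by a constant matrix removes the top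
    coefficient of Q. *)
Lemma monic_expansion (P : nat -> M) n Q : (forall k, mxmonic k (P k)) ->
  (forall k, (n <= k)%N -> map_mx (coefp k) Q = 0) ->
  exists A : nat -> 'M[C]_2, Q = \sum_(k < n) map_mx polyC (A k) *m P k.
Proof.
move=> monP; elim: n Q => [|n IHn] Q hQ.
  exists (fun _ => 0); rewrite big_ord0; apply: mx_coefP => k.
  by rewrite hQ // raddf0.
have [|A hA] := IHn (Q - map_mx polyC (map_mx (coefp n) Q) *m P n).
  move=> k; rewrite raddfB /= coefp_constM leq_eqVlt => /predU1P[<-|lt_nk].
    by rewrite (monP n).1 mulmx1 subrr.
  by rewrite (monP n).2 // mulmx0 subr0 hQ.
exists (fun k => if k == n then map_mx (coefp n) Q else A k).
rewrite big_ord_recr /= eqxx -[LHS](subrK (map_mx polyC (map_mx (coefp n) Q) *m P n)) hA.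
by congr (_ + _); apply: eq_bigr => k _; rewrite ltn_eqF.
Qed.

Lemma mxinner0l Q : mxinner W 0 Q = 0.
Proof. by apply: (@addrI _ (mxinner W 0 Q)); rewrite -mxinnerDl !addr0. Qed.

Lemma mxinner_suml I (e : seq I) (F : I -> M) Q :
  mxinner W (\sum_(k <- e) F k) Q = \sum_(k <- e) mxinner W (F k) Q.
Proof.
exact: (big_morph (mxinner W ^~ Q) (fun P P' => mxinnerDl P P' Q) (mxinner0l Q)).
Qed.

(** The difference P_n - P'_n has degree below n, hence expands in the P'_k with k < n. Pairing with
    P'_j, which equals P_j by induction, isolates the coefficient A_j, and the Gram hypothesis kills
    it. *)
Lemma monic_orthogonal_unique (P P' : nat -> M) :
  monic_orthogonal W P -> monic_orthogonal W P' ->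
  (forall (n : nat) (A : 'M[C]_2), A *m mxinner W (P' n) (P' n) = 0 -> A = 0) ->
  forall n, P n = P' n.
Proof.
move=> [monP orthP] [monP' orthP'] gram; elim/ltn_ind => n IHn.
have [A hA] : exists A : nat -> 'M[C]_2,
    P n - P' n = \sum_(k < n) map_mx polyC (A k) *m P' k.
  apply: monic_expansion => // k; rewrite raddfB /= leq_eqVlt => /predU1P[<-|lt_nk].
    by rewrite (monP n).1 (monP' n).1 subrr.
  by rewrite (monP n).2 ?(monP' n).2 // subrr.
apply/eqP; rewrite -subr_eq0 hA big1 // => j _.
suff -> : A j = 0 by rewrite raddf0 mul0mx.
apply: (gram j); have ne : n != j by rewrite gtn_eqF.
have := mxinnerDl (P n - P' n) (P' n) (P' j).
rewrite subrK -{1}IHn // orthP // orthP' // addr0 hA mxinner_suml.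
rewrite (bigD1 j) //= mxinnerMl big1 ?addr0 // => i ne_ij.
by rewrite mxinnerMl orthP' ?mulmx0.
Qed.

(** The ratio of the total masses; for the Gaussian integrals it is e^(-b^2). *)
Definition kap : C := L0 1 / Lb 1.
(* This value of tau makes the two rows of Bt orthogonal. *)
Definition tau : C := a%:C * kap / 2.

Lemma kap_gt0 : 0 < kap.
Proof. by rewrite divr_gt0 ?hL0.2 ?hLb.2. Qed.

Lemma conj_real (x : R) : Num.conj x%:C = x%:C.
Proof. exact: conjc_real. Qed.

Lemma conj_kap : Num.conj kap = kap.
Proof. exact/CrealP/gtr0_real/kap_gt0. Qed.

Lemma conj_tau : Num.conj tau = tau.
Proof.
rewrite /tau; move: kap conj_kap => k hk.
by rewrite !rmorphM fmorphV /= hk conj_real rmorph_nat.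
Qed.

(** a tau = a^2 kap / 2 is nonnegative because a is real and [kap] is positive. *)
Lemma tau_neq0 n : 1 + a%:C * tau * n%:R != 0.
Proof.
have -> : 1 + a%:C * tau * n%:R = 1 + (a ^+ 2)%:C * (kap * (n%:R / 2)).
  by rewrite /tau rmorphXn /=; ring.
rewrite gt_eqF // ltr_pwDl //; apply: mulr_ge0; first by rewrite ler0c sqr_ge0.
by rewrite mulr_ge0 ?(ltW kap_gt0) // divr_ge0 ?ler0n.
Qed.

Lemma conj_herm (x : R) n : conj_poly (herm x%:C n) = herm x%:C n.
Proof.
elim: n => [|n IHn]; first by rewrite herm0 rmorph1.
rewrite hermS rmorphB rmorphM /= rmorphB /= map_polyX map_polyC map_polyZ -deriv_map IHn /=.
by rewrite conj_real fmorphV rmorph_nat.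
Qed.

(** * The explicit orthogonal polynomials *)

Definition Bt n : M := mx22 (H n) (a%:C *: h n.+1) (- tau *: (H n)^`()) (h n).
Definition Bn n : M := Bt n *m Ti.

Lemma BnT n : Bn n *m T = Bt n.
Proof. by rewrite /Bn -mulmxA TinvK mulmx1. Qed.

Lemma conj_Bt n i j : conj_poly (Bt n i j) = Bt n i j.
Proof.
have ch m : conj_poly (h m) = h m by exact: (conj_herm 0).
rewrite /Bt mxE; case: ifP => _; case: ifP => _.
- exact: conj_herm.
- by rewrite map_polyZ /= conj_real ch.
- by rewrite map_polyZ /= rmorphN /= conj_tau -deriv_map conj_herm.
- exact: ch.
Qed.

Lemma wform_Bn n m i j : wform (Bn n) (Bn m) i j =
  Lb (Bt n i 0 * Bt m j 0) + L0 (Bt n i 1 * Bt m j 1).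
Proof. by rewrite /wform !BnT !conj_Bt. Qed.

Lemma herm_norm_kap n : herm_norm L0 n = kap * herm_norm Lb n.
Proof.
have : Lb 1 != 0 by rewrite gt_eqF ?hLb.2.
rewrite /herm_norm /kap; move: (_ / _) (L0 1) (Lb 1) => u v w w0; by field.
Qed.

Lemma gram_Bn00 n m : wform (Bn n) (Bn m) 0 0 =
  (herm_norm Lb n + a%:C ^+ 2 * herm_norm L0 n.+1) *+ (n == m).
Proof.
rewrite wform_Bn !mxE /= scalarZl [X in L0 X]mulrC scalarZl.
rewrite (gauss_herm_orth hLb) (gauss_herm_orth hL0) eqSS [m == n]eq_sym.
case: (eqVneq n m) => [->|_]; rewrite ?mulr1n ?mulr0n ?mulr0 ?addr0 //.
by rewrite expr2 mulrA.
Qed.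

(** Only m = n + 1 contributes. There the Lb term -tau m |H_n|^2 cancels the L0 term a |h_m|^2,
    since |h_m|^2 = (m / 2) kap |H_n|^2. *)
Lemma gram_Bn01 n m : wform (Bn n) (Bn m) 0 1 = 0.
Proof.
rewrite wform_Bn !mxE /= [X in Lb X]mulrC !scalarZl [X in Lb X]mulrC deriv_herm.
rewrite (gauss_herm_orth hL0) mulrnAr raddfMn /= (gauss_herm_orth hLb).
case: m => [|m] /=; first by rewrite !mulr0n !mulr0 addr0.
rewrite eqSS; case: eqP => [->|_]; rewrite ?mulr0n ?mul0rn ?mulr0 ?addr0 // !mulr1n.
by rewrite (herm_normS L0) herm_norm_kap /tau -mulr_natr; ring.
Qed.

Lemma gram_Bn10 n m : wform (Bn n) (Bn m) 1 0 = 0.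
Proof.
rewrite -(gram_Bn01 m n) !wform_Bn.
by rewrite [Bt n 1 0 * _]mulrC [Bt n 1 1 * _]mulrC.
Qed.

Lemma gram_Bn11 n m : wform (Bn n) (Bn m) 1 1 =
  (tau ^+ 2 * n%:R ^+ 2 * herm_norm Lb n.-1 + herm_norm L0 n) *+ (n == m).
Proof.
rewrite wform_Bn !mxE /= scalarZl [X in Lb X]mulrC scalarZl (gauss_herm_orth hL0) !deriv_herm.
rewrite mulrnAl mulrnAr !raddfMn /= (gauss_herm_orth hLb).
case: (eqVneq n m) => [->|ne].
  rewrite !eqxx !mulr1n; move: (herm_norm _ _) (herm_norm _ _) tau => u v t; ring.
rewrite !mulr0n addr0; case: n m ne => [|n] [|m] //= ne; rewrite ?mulr0n ?mul0rn ?mulr0 //.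
rewrite eqSS eq_sym in ne.
by rewrite (negPf ne) mulr0n !mul0rn !mulr0.
Qed.

Definition Gram n : 'M[C]_2 := mx22 (herm_norm Lb n + a%:C ^+ 2 * herm_norm L0 n.+1) 0
  0 (tau ^+ 2 * n%:R ^+ 2 * herm_norm Lb n.-1 + herm_norm L0 n).

Lemma mxinner_Bn n m : mxinner W (Bn n) (Bn m) = if n == m then Gram n else 0.
Proof.
rewrite mxinner_W; apply: eq_mx22; rewrite mxE
  ?(gram_Bn00, gram_Bn01, gram_Bn10, gram_Bn11); by case: eqP => _; rewrite !mxE.
Qed.

Lemma Gram_unit n : Gram n \in unitmx.
Proof.
have a2 : 0 <= a%:C ^+ 2 by rewrite -rmorphXn /= ler0c sqr_ge0.
have t2 : 0 <= tau ^+ 2.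
  rewrite /tau -mulrA exprMn mulr_ge0 // exprn_ge0 // divr_ge0 ?ltW ?kap_gt0 //.
have g1 : herm_norm Lb n + a%:C ^+ 2 * herm_norm L0 n.+1 != 0.
  by rewrite gt_eqF // ltr_pwDl ?(herm_norm_gt0 hLb) // mulr_ge0 // ltW ?(herm_norm_gt0 hL0).
have g2 : tau ^+ 2 * n%:R ^+ 2 * herm_norm Lb n.-1 + herm_norm L0 n != 0.
  rewrite gt_eqF // ltr_wpDl ?(herm_norm_gt0 hL0) //.
  apply: mulr_ge0; last exact: ltW (herm_norm_gt0 hLb _).
  by apply: mulr_ge0 => //; apply: exprn_ge0; rewrite ler0n.
have : Gram n *m mx22 (Gram n 0 0)^-1 0 0 (Gram n 1 1)^-1 = 1%:M.
  by apply: eq_mx22; rewrite mulmx2E !mxE /= ?mulr0 ?mul0r ?addr0 ?add0r ?mulfV.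
by case/mulmx1_unit.
Qed.

Lemma BnE n : Bn n = mx22 (H n) (a%:C *: (h n.+1 - 'X * H n))
  (- tau *: (H n)^`()) (h n + (a%:C * tau) *: ('X * (H n)^`())).
Proof.
rewrite /Bn /Bt /Tinv; apply: eq_mx22; rewrite mulmx2E !mxE /= ?mulr0 ?mulr1 ?addr0 //.
  by rewrite -!mul_polyC; move: (h n.+1) (H n) => u v; ring.
move: (h n) (H n)^`() tau => u v t.
by rewrite -!mul_polyC polyCN polyCM; ring.
Qed.

Lemma coef_herm_lead (x : C) n : (herm x n)`_n = 1.
Proof. by have := monicP (herm_monic x n); rewrite /lead_coef size_herm. Qed.

Lemma coef_herm_gt (x : C) n k : (n < k)%N -> (herm x n)`_k = 0.
Proof. by move=> lt; rewrite nth_default // size_herm. Qed.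

(** T^-1 could raise the degree by one, but h_(n+1) and X H_n are both monic of degree n + 1, so
    their top terms cancel. *)
Lemma coef_Bn_gt n k : (n < k)%N -> map_mx (coefp k) (Bn n) = 0.
Proof.
move=> lt_nk; rewrite BnE; apply: eq_mx22; rewrite !mxE /=.
- exact: coef_herm_gt.
- rewrite coefZ coefB coefXM; case: k lt_nk => // k; rewrite ltnS leq_eqVlt => /predU1P[<-|lt].
    by rewrite !coef_herm_lead subrr mulr0.
  by rewrite !coef_herm_gt // subrr mulr0.
- by rewrite coefZ coef_deriv coef_herm_gt ?mul0rn ?mulr0 // leqW.
- rewrite coefD coef_herm_gt // coefZ coefXM; case: k lt_nk => // k lt.
  by rewrite coef_deriv coef_herm_gt ?mul0rn ?mulr0 ?addr0.
Qed.

Definition Kn n : 'M[C]_2 := map_mx (coefp n) (Bn n).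

Lemma KnE n : [/\ Kn n 0 0 = 1, Kn n 1 0 = 0 & Kn n 1 1 = 1 + a%:C * tau * n%:R].
Proof.
rewrite /Kn BnE; split; rewrite !mxE /= ?coef_herm_lead //.
  by rewrite coefZ coef_deriv coef_herm_gt ?mul0rn ?mulr0.
rewrite coefD coef_herm_lead coefZ coefXM; case: n => [|n]; first by rewrite !mulr0.
by rewrite coef_deriv coef_herm_lead.
Qed.

(** The leading coefficient of B_n is upper triangular with determinant 1 + a tau n. *)
Lemma Kn_unit n : Kn n \in unitmx.
Proof.
have [k00 k10 k11] := KnE n; have := tau_neq0 n; rewrite -k11.
move: (Kn n) k00 k10 => K k00 k10 d0.
have : K *m mx22 1 (- (K 0 1) / K 1 1) 0 (K 1 1)^-1 = 1%:M.
  apply: eq_mx22; rewrite mulmx2E !mxE /= ?k00 ?k10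
    ?(mulr0, mul0r, addr0, add0r, mulr1, mul1r, mulNr, addNr) // mulfV //.
by case/mulmx1_unit.
Qed.

Definition Pn n : M := map_mx polyC (invmx (Kn n)) *m Bn n.

Lemma polyC_mxM (A A' : 'M[C]_2) :
  map_mx polyC (A *m A') = map_mx polyC A *m map_mx polyC A'.
Proof. exact: map_mxM. Qed.

Lemma Bn_Pn n : Bn n = map_mx polyC (Kn n) *m Pn n.
Proof. by rewrite /Pn mulmxA -polyC_mxM mulmxV ?Kn_unit // map_mx1 mul1mx. Qed.

Lemma Pn_monic_orthogonal : monic_orthogonal W Pn.
Proof.
split=> [n|n m ne].
  split=> [|k lt_nk]; rewrite coefp_constM; first by rewrite mulVmx ?Kn_unit.
  by rewrite coef_Bn_gt ?mulmx0.
by rewrite /Pn mxinnerMl mxinnerMr mxinner_Bn (negPf ne) mul0mx mulmx0.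
Qed.

Lemma Pn_gram n (A : 'M[C]_2) : A *m mxinner W (Pn n) (Pn n) = 0 -> A = 0.
Proof.
rewrite /Pn mxinnerMl mxinnerMr mxinner_Bn eqxx => hA.
have uK : adjmx (invmx (Kn n)) \in unitmx.
  by rewrite map_unitmx unitmx_tr unitmx_inv Kn_unit.
have uI : invmx (Kn n) \in unitmx by rewrite unitmx_inv Kn_unit.
move: hA; rewrite !mulmxA => /(canRL (mulmxK uK)); rewrite mul0mx.
by move/(canRL (mulmxK (Gram_unit n))); rewrite mul0mx => /(canRL (mulmxK uI)); rewrite mul0mx.
Qed.

(** By uniqueness the monic sequence is [Pn]. Constant matrices on the left commute with the right
    action, so passing to B_n only conjugates the eigenvalue matrix by [Kn]. *)
Lemma DW_Bn E : DW W E <->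
  forall n, exists L : 'M[C]_2, dop_act (Bn n) E = map_mx polyC L *m Bn n.
Proof.
split=> [[P oP hP] n | hB].
  have ePn := monic_orthogonal_unique oP Pn_monic_orthogonal Pn_gram.
  have [L hL] := hP n; exists (Kn n *m L *m invmx (Kn n)).
  by rewrite Bn_Pn dop_act_constM -ePn hL ePn !polyC_mxM -!mulmxA -/(Pn n) -Bn_Pn.
exists Pn; first exact: Pn_monic_orthogonal.
move=> n; have [L hL] := hB n; exists (invmx (Kn n) *m L *m Kn n).
by rewrite {1}/Pn dop_act_constM hL !polyC_mxM -!mulmxA -Bn_Pn.
Qed.

(** * Eigenvectors of D and polynomials in D *)

Lemma D_ex_row (c : C) p q r s :
  p^`()^`() - ('X - b%:C%:P) * p^`() *+ 2 - p *+ 2 = c *: p ->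
  q^`()^`() - ('X - 0%:P) * q^`() *+ 2 = c *: q ->
  r^`()^`() - ('X - b%:C%:P) * r^`() *+ 2 - r *+ 2 = c *: r ->
  s^`()^`() - ('X - 0%:P) * s^`() *+ 2 = c *: s ->
  dop_act (mx22 p q r s *m Ti) D = c%:P *: (mx22 p q r s *m Ti).
Proof.
move=> hp hq hr hs; rewrite D_ex_act hp hq hr hs scalemxAl; congr (_ *m _).
by apply: eq_mx22; rewrite !mxE /= mul_polyC.
Qed.

Lemma zero_eigen1 (c x : C) :
  (0 : {poly C})^`()^`() - ('X - x%:P) * (0 : {poly C})^`() *+ 2 = c *: 0.
Proof. by rewrite !deriv0 mulr0 mul0rn subr0 scaler0. Qed.

Lemma zero_eigen2 (c x : C) :
  (0 : {poly C})^`()^`() - ('X - x%:P) * (0 : {poly C})^`() *+ 2 - 0 *+ 2 = c *: 0.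
Proof. by rewrite (zero_eigen1 c) mul0rn subr0. Qed.

Lemma scale_eigen (x c k : C) p :
  p^`()^`() - ('X - x%:P) * p^`() *+ 2 = c *: p ->
  (k *: p)^`()^`() - ('X - x%:P) * (k *: p)^`() *+ 2 = c *: (k *: p).
Proof.
by move=> e; rewrite scalerA [c * k]mulrC -scalerA -e !derivZ -scalerAr scalerBr scalerMnr.
Qed.

Lemma H_eigen n :
  (H n)^`()^`() - ('X - b%:C%:P) * (H n)^`() *+ 2 - H n *+ 2 = (- 2 * n.+1%:R) *: H n.
Proof.
by rewrite herm_eigen -[H n *+ 2]scaler_nat -scalerBl; congr (_ *: _); ring.
Qed.

Lemma D_ex_H n : dop_act (mx22 (H n) 0 0 0 *m Ti) D =
  (- 2 * n.+1%:R)%:P *: (mx22 (H n) 0 0 0 *m Ti).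
Proof.
apply: D_ex_row; first exact: H_eigen.
- exact: zero_eigen1.
- exact: zero_eigen2.
- exact: zero_eigen1.
Qed.

Lemma D_ex_h n : dop_act (mx22 0 (h n) 0 0 *m Ti) D =
  (- 2 * n%:R)%:P *: (mx22 0 (h n) 0 0 *m Ti).
Proof.
apply: D_ex_row; first exact: zero_eigen2.
- exact: herm_eigen.
- exact: zero_eigen2.
- exact: zero_eigen1.
Qed.

(** The shift by -2 gives H_n the eigenvalue of h_(n+1), so the whole first row of B_n is an
    eigenvector. The second row works likewise, because H_n' is a multiple of H_(n-1). *)
Lemma D_ex_Bt0 n : dop_act (mx22 (H n) (a%:C *: h n.+1) 0 0 *m Ti) D =
  (- 2 * n.+1%:R)%:P *: (mx22 (H n) (a%:C *: h n.+1) 0 0 *m Ti).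
Proof.
apply: D_ex_row; [exact: H_eigen | | exact: zero_eigen2 | exact: zero_eigen1].
exact/scale_eigen/herm_eigen.
Qed.

Lemma D_ex_Bt1 n : dop_act (mx22 0 0 (- tau *: (H n)^`()) (h n) *m Ti) D =
  (- 2 * n%:R)%:P *: (mx22 0 0 (- tau *: (H n)^`()) (h n) *m Ti).
Proof.
apply: D_ex_row; [exact: zero_eigen2 | exact: zero_eigen1 | | exact: herm_eigen].
rewrite deriv_herm; case: n => [|n].
  by rewrite mulr0n scaler0; exact: zero_eigen2.
rewrite (scale_eigen (c := - 2 * n%:R)).
  by rewrite -[X in _ - X]scaler_nat -scalerBl; congr (_ *: _); ring.
by rewrite -[H _ *+ _]scaler_nat; apply: scale_eigen; exact: herm_eigen.
Qed.

(** The rows of B_n are eigenvectors of D for -2 (n + 1) and -2n, so g(D) multiplies B_n on the left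
    by the diagonal matrix of the values of g there. *)
Lemma DW_horner (g : {poly C}) : DW W (horner_alg D g).
Proof.
apply/DW_Bn => n; exists (mx22 g.[- 2 * n.+1%:R] 0 0 g.[- 2 * n%:R]).
have BnD : Bn n = mx22 (H n) (a%:C *: h n.+1) 0 0 *m Ti
    + mx22 0 0 (- tau *: (H n)^`()) (h n) *m Ti.
  rewrite -mulmxDl addmx22 !addr0 !add0r //.
rewrite {1}BnD dop_actDl (dop_act_horner _ (D_ex_Bt0 n)) (dop_act_horner _ (D_ex_Bt1 n)).
rewrite /Bn mulmxA !scalemxAl -mulmxDl; congr (_ *m _).
move: g.[_] g.[_] => u v; rewrite /Bt.
apply: eq_mx22; rewrite mulmx2E !mxE /=; by rewrite ?(mulr0, mul0r, addr0, add0r).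
Qed.

(** If g(D) = 0, then g vanishes at every eigenvalue -2n of D, hence at more points than its
    degree. *)
Lemma horner_alg_D_inj : injective (horner_alg D).
Proof.
move=> g1 g2 e12; apply/eqP; rewrite -subr_eq0; apply/eqP.
set g := g1 - g2; have g0 : horner_alg D g = 0 by rewrite rmorphB /= e12 subrr.
have rg (n : nat) : root g (- 2 * n%:R).
  have := dop_act_horner g (D_ex_h n); rewrite g0 dop_act0r scalemxAl.
  move/(congr1 (mulmx^~ T)); rewrite mul0mx -mulmxA TinvK mulmx1 => /matrixP/(_ 0 1).
  rewrite !mxE /= => /esym/eqP.
  by rewrite mulf_eq0 (negPf (herm_neq0 _ _)) orbF polyC_eq0.
apply: (@roots_geq_poly_eq0 _ _ (mkseq (fun n => - 2 * n%:R) (size g))).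
- by apply/allP => _ /mapP[n _ ->].
- rewrite mkseq_uniq // => n m /mulfI; rewrite oppr_eq0 pnatr_eq0 => /(_ isT)/eqP.
  by rewrite eqr_nat => /eqP.
- by rewrite size_mkseq.
Qed.

(** * Every operator of the algebra is a polynomial in D *)

Hypotheses (a0 : a != 0) (b0 : b != 0).

Lemma DW_sub_horner E : DW W E -> exists g : {poly C}, E = horner_alg D g.
Proof.
move=> /DW_Bn hE; set Et := dop_conj a%:C E.
have Et_act P : dop_act P Et = dop_act (P *m Ti) E *m T by exact: dop_act_conj.
have sum2 (F : 'I_2 -> {poly C}) : \sum_l F l = F 0 + F 1.
  by rewrite big_ord_recl big_ord1; congr (_ + F _); exact: val_inj.
(* The four entries of the eigenvalue equation of T^-1 E T on B_n T, in the form the rigidity lemmas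
   expect. *)
have hf n : exists l00 l01 l10 l11 : C,
  [/\ dop_entry Et 0 0 (H n) + a%:C *: dop_entry Et 1 0 (h n.+1)
        = l00 *: H n - (l01 * tau) *: (H n)^`(),
      dop_entry Et 0 1 (H n) + a%:C *: dop_entry Et 1 1 (h n.+1)
        = (l00 * a%:C) *: h n.+1 + l01 *: h n,
      - (tau *: dop_entry Et 0 0 (H n)^`()) + dop_entry Et 1 0 (h n)
        = l10 *: H n - (l11 * tau) *: (H n)^`()
    & - (tau *: dop_entry Et 0 1 (H n)^`()) + dop_entry Et 1 1 (h n)
        = (l10 * a%:C) *: h n.+1 + l11 *: h n].
  have [L hL] := hE n; exists (L 0 0), (L 0 1), (L 1 0), (L 1 1).
  have hB : dop_act (Bt n) Et = map_mx polyC L *m Bt n.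
    by rewrite Et_act -/(Bn n) hL -mulmxA BnT.
  have hBij i j : dop_entry Et 0 j (Bt n i 0) + dop_entry Et 1 j (Bt n i 1) =
      L i 0 *: Bt n 0 j + L i 1 *: Bt n 1 j.
    have /matrixP/(_ i j) := hB; rewrite dop_act_entry sum2 mulmx2E => ->.
    by rewrite [map_mx _ _ i 0]mxE [map_mx _ _ i 1]mxE !mul_polyC.
  have eB : [/\ Bt n 0 0 = H n, Bt n 0 1 = a%:C *: h n.+1,
      Bt n 1 0 = - tau *: (H n)^`() & Bt n 1 1 = h n].
    by rewrite /Bt; split; rewrite !mxE.
  have [B00 B01 B10 B11] := eB.
  split.
  - have := hBij 0 0; rewrite B00 B01 B10 linearZ /= => ->.
    by rewrite scalerA mulrN scaleNr.
  - by have := hBij 0 1; rewrite B00 B01 B11 linearZ /= => ->; rewrite scalerA.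
  - have := hBij 1 0; rewrite B00 B10 B11 linearZ /=.
    rewrite -[- (tau *: dop_entry _ _ _ _)]scaleNr => ->.
    by rewrite scalerA mulrN scaleNr.
  - have := hBij 1 1; rewrite B01 B10 B11 linearZ /=.
    rewrite -[- (tau *: dop_entry _ _ _ _)]scaleNr => ->.
    by rewrite scalerA.
have aC0 : a%:C != 0 :> C by rewrite fmorph_eq0.
have bC0 : b%:C != 0 :> C by rewrite fmorph_eq0.
have adj01 := adjointable_dop_entry Et 0 1 hL0.
have adj10 := adjointable_dop_entry Et 1 0 hLb.
have f10 := offdiag10_eq0 hL0 hLb bC0 tau_neq0 adj10 hf.
have f01 := offdiag01_eq0 hL0 hLb bC0 tau_neq0 adj01 hf.
have [beta [h11 h00]] := diag_eigen hL0 hLb aC0 bC0 tau_neq0 adj01 adj10 hf.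
have [g hg] : exists g : {poly C}, forall n, beta n = g.[- 2 * n%:R].
  apply: (@diffop_eigenvalue_poly _ _ (fun k => (dop_coef Et)`_k 1 1) 0 beta); last exact: h11.
  exact: (size_herm_diag h11).
exists g; apply/eqP; rewrite -subr_eq0; apply/eqP.
have back P (c : C) : dop_act P Et = c%:P *: P -> dop_act (P *m Ti) E = c%:P *: (P *m Ti).
  rewrite Et_act => /(congr1 (mulmx^~ Ti)).
  by rewrite -mulmxA TmxK mulmx1 => ->; rewrite scalemxAl.
(* E and g(D) agree on both Hermite families: beta_(n+1) = g(-2 (n + 1)) on the H_n, beta_n = g(-2n)
   on the h_n. *)
apply: (@dop_herm_eq0 _ a%:C _ b%:C 0) => n; rewrite dop_actDr dop_actNr.
- rewrite (dop_act_horner g (D_ex_H n)) -hg (back _ (beta n.+1)) ?subrr //.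
  apply: eq_mx22; rewrite dop_act_entry sum2 !mxE /= ?raddf0 ?addr0 ?mulr0 ?h00 ?f01 //.
  by rewrite mul_polyC.
- rewrite (dop_act_horner g (D_ex_h n)) -hg (back _ (beta n)) ?subrr //.
  apply: eq_mx22; rewrite dop_act_entry sum2 !mxE /= ?raddf0 ?add0r ?mulr0 ?h11 ?f10 //.
  by rewrite mul_polyC.
Qed.

Lemma D_ex_algebra :
  [/\ DW W D, DW W = [set E | DW W E /\ E * D = D * E],
      DW W = range (horner_alg D) & injective (horner_alg D)].
Proof.
have rangeE : DW W = range (horner_alg D).
  apply/seteqP; split=> [E /DW_sub_horner[g ->]|_ [g _ <-]]; first by exists g.
  exact: DW_horner.
split=> //; last exact: horner_alg_D_inj.
- by rewrite -(horner_algX D); exact: DW_horner.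
- apply/seteqP; split=> E /=; last by case.
  move=> hE; split=> //; have [g ->] := DW_sub_horner hE.
  by rewrite -{2 3}(horner_algX D) -!rmorphM mulrC.
Qed.

End HermiteTypeWeight.

(** * The inner product of the concrete weight *)

Section Weight.
Variables (R : realType) (a b : R).
Local Notation C := R[i].
Local Open Scope complex_scope.
Local Notation T := (Tmx a%:C).
Implicit Types (P Q : 'M[{poly C}]_2).

Lemma conj_poly_horner (q : {poly C}) (x : R) :
  (map_poly Num.conj q).[x%:C] = Num.conj q.[x%:C].
Proof.
rewrite -[in LHS](_ : Num.conj x%:C = x%:C) ?horner_map //; exact: conjc_real.
Qed.

(** Pointwise W = T diag(w_b, w_0) T^* with w_c the weight [gauss_weight c]; the integrand is thus a
    polynomial times w_b plus a polynomial times w_0, as in [cintegral_gauss]. *)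
Lemma mxinner_W_ex P Q : mxinner (W_ex a b) P Q =
  \matrix_(i, j) wform a (cmoment (0 : R)) (cmoment b) P Q i j.
Proof.
apply/matrixP => i j; rewrite ![LHS]mxE ![RHS]mxE /wform /=.
rewrite -cintegral_gauss; congr cintegral; apply/funext => x.
have eT Q' k : (Q' *m T) k 0 = Q' k 0 /\
    (Q' *m T) k 1 = Q' k 0 * (a%:C *: 'X) + Q' k 1.
  by rewrite !mulmx2E !mxE /= !mulr1 mulr0 addr0.
have cJ (y : R) : Num.conj y%:C = y%:C by exact: conjc_real.
have [-> ->] := eT P i; have [-> ->] := eT Q j.
have eW : [/\ W_ex a b x 0 0 =
      (gauss_weight b x)%:C + (a%:C * x%:C) ^+ 2 * (gauss_weight 0 x)%:C,
    W_ex a b x 0 1 = (a%:C * x%:C) * (gauss_weight 0 x)%:C,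
    W_ex a b x 1 0 = (a%:C * x%:C) * (gauss_weight 0 x)%:C
    & W_ex a b x 1 1 = (gauss_weight 0 x)%:C].
  rewrite /W_ex /gauss_weight mulr0 mul0r expR0 mulr1 -mulrA; split; rewrite !mxE /=.
  - by rewrite -!(rmorphM, rmorphXn, rmorphD) /=; congr (_%:C); ring.
  - by rewrite -!rmorphM /= mulrC.
  - by rewrite -!rmorphM /= mulrC.
  - by rewrite mulr1.
have eQ k : adjmx (mxeval Q x%:C) k j = Num.conj (Q j k).[x%:C] by rewrite !mxE.
have eP k : mxeval P x%:C i k = (P i k).[x%:C] by rewrite mxE.
rewrite !mulmx2E !eQ !eP; have [-> -> -> ->] := eW.
rewrite !hornerM !conj_poly_horner !hornerD !hornerM !hornerZ !hornerX.
rewrite !(rmorphD, rmorphM) /= !cJ.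
move: (P i 0).[_] (P i 1).[_] (Num.conj (Q j 0).[_]) (Num.conj (Q j 1).[_]) => p0 p1 q0 q1.
ring.
Qed.

End Weight.

Theorem theorem3p11 (R : realType) (a b : R) (ha : a != 0) (hb : b != 0) :
  [/\ DW (W_ex a b) (D_ex a b),
      DW (W_ex a b) =
        [set E | DW (W_ex a b) E /\ E * D_ex a b = D_ex a b * E],
      DW (W_ex a b) = range (horner_alg (D_ex a b))
    & injective (horner_alg (D_ex a b))].
Proof.
exact: (D_ex_algebra (cmoment_gauss 0) (cmoment_gauss b) (@mxinner_W_ex R a b) ha hb).
Qed.
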